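(* For every graph $\Gamma$, the maps $\phi:Gr(\Gamma)\to F(\Gamma)$ and $\psi:F(\Gamma)\to Gr(\Gamma)$ are mutually inverse $*$-isomorphisms between $Gr(\Gamma)$ and $F(\Gamma)$ that intertwine the functionals $\tau$ and $t$ (i.e. $t\circ\phi=\tau$).
   Context: Graphs. A graph $\Gamma$ means a finite, weighted, bipartite graph: a finite vertex set $V=V_0\sqcup V_1$, a finite set $E$ of oriented edges with start and finish maps $s,f:E\to V$ and a reversal involution $\xi\mapsto\tilde\xi$ of $E$ interchanging $s$ and $f$, such that $s(\xi)\in V_0\Leftrightarrow f(\xi)\in V_1$, and a weighting $\mu:V\to(0,\infty)$ with $\sum_{v\in V}\mu^2(v)=1$. A path $\xi$ of length $n\ge 0$ is $(v^\xi_0\xrightarrow{\xi_1}v^\xi_1\cdots\xrightarrow{\xi_n}v^\xi_n)$ with $\xi_i\in E$ an edge from $v^\xi_{i-1}$ to $v^\xi_i$; $s(\xi)=v_0^\xi$, $f(\xi)=v_n^\xi$; $\xi_{[i,j]}$ is the subpath from $v^\xi_i$ to $v^\xi_j$; $\tilde\xi$ is the reversed path. $P_n(\Gamma)$ is the complex vector space with basis $\{[\xi]:\xi\text{ a path of length }n\}$. $Gr(\Gamma)=\bigoplus_{n\ge0}P_n(\Gamma)$ with product $[\xi]\bullet[\eta]=[\xi\circ\eta]$ if $f(\xi)=s(\eta)$ and $0$ otherwise, involution the conjugate-linear extension of $[\xi]^*=[\tilde\xi]$, and functional $\tau$: $\tau([(v)])=\mu^2(v)$ on length zero paths, and for $\xi$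 of length $n\ge1$, $\tau([\xi])=\sum_T\tau_T([\xi])$ over all Temperley–Lieb equivalence relations $T$ on $\{1,\dots,n\}$ (non-crossing partitions all of whose classes have two elements), with $$\tau_T([\xi])=\prod_{\{i,j\}\in T,\,i<j}\delta_{\xi_i,\widetilde{\xi_j}}\prod_{C\in K(T)}\mu(v_C^\xi)^{2-|C|},$$ where $K(T)$ is the Kreweras complement of $T$ (the largest partition of $\{1',\dots,n'\}\cong\{1,\dots,n\}$ whose union with $T$ is non-crossing on $1<1'<2<2'<\cdots<n<n'$) and $v_C^\xi=v_c^\xi$ for any $c\in C$ (these coincide when the first product is non-zero). $F(\Gamma)=\bigoplus_{n\ge0}P_n(\Gamma)$ with the same involution, and product: for $\xi,\eta$ of lengths $m,n$, $[\xi]\#[\eta]=0$ if $f(\xi)\neq s(\eta)$, otherwise $$[\xi]\#[\eta]=\sum_{k=0}^{\min\{m,n\}}\Big(\prod_{i=1}^k\delta_{\xi_{m+1-i},\widetilde{\eta_i}}\Big)\frac{\mu(f(\xi))}{\mu(v^\xi_{m-k})}\,[\xi_{[0,m-k]}\circ\eta_{[k,n]}],$$ and functional $t$ vanishing on $P_n(\Gamma)$ for $n\ge1$ with $t([(v)])=\mu^2(v)$. The category $\mathcal E$ (epi-TL). Its objects are $[n]$, $n\ge0$ ($n$ points on a line); a morphism in $\mathrm{Hom}([n],[m])$ is a planar (Temperley–Lieb type) diagram in a rectangle with $n$ points at the bottom and $m$ points at the top in which every top point is joined to a bottom point. Such an $S$ is given by the set $T\subseteq\{1,\dots,n\}$ of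 bottom points joined to the top, and a non-crossing pairing $\sim$ of the complement (the ''caps''), with no element of $T$ lying under a cap. It acts as a linear map $P_n(\Gamma)\to P_m(\Gamma)$ by $$S([\xi])=\prod_{\{i,j\}\in\,\sim,\ i<j}\Big(\delta_{\xi_i,\widetilde{\xi_j}}\frac{\mu(v^\xi_i)}{\mu(v^\xi_j)}\Big)\,[\circ_{t\in T}\,\xi_t],$$ concatenating in increasing order of $t\in T$, interpreted as $[(f(\xi))]$ if $T=\emptyset$. $S$ is non-nested if no cap of $S$ lies under another cap. The map $\phi$ is given on $P_n(\Gamma)$ by components $\phi_n^m:P_n(\Gamma)\to P_m(\Gamma)$, where $\phi_n^m$ is the sum of (the actions of) all elements of $\mathrm{Hom}([n],[m])$; $\psi$ has components $\psi^m_n$ equal to $(-1)^{(n-m)/2}$ times the sum of all non-nested elements of $\mathrm{Hom}([n],[m])$ (components are zero when $\mathrm{Hom}([n],[m])=\emptyset$, i.e. unless $n-m$ is a non-negative even integer). *)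

(* Defs.v *)
From mathcomp Require Import all_boot all_order all_algebra.
From mathcomp Require Import finmap reals complex.
From mathcomp.multinomials Require Import monalg.

Set Implicit Arguments.
Unset Strict Implicit.
Unset Printing Implicit Defensive.

Import Order.TTheory GRing.Theory Num.Theory.
Local Open Scope ring_scope.
Local Open Scope complex_scope.

(* [V_0] is the set of vertices with [side v = false]. *)
Record graph (R : realType) := Graph {
  vert : finType;
  edge : finType;
  esrc : edge -> vert;
  etgt : edge -> vert;
  erev : edge -> edge;
  side : vert -> bool;
  mu : vert -> R;
  erevK : involutive erev;
  esrc_erev : forall e, esrc (erev e) = etgt e;
  etgt_erev : forall e, etgt (erev e) = esrc e;
  side_edge : forall e, ~~ side (esrc e) <-> side (etgt e);
  mu_gt0 : forall v, 0 < mu v;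
  sum_mu2 : \sum_v mu v ^+ 2 = 1
}.

Section Paths.
Variables (R : realType) (G : graph R).

Fixpoint walk (v : vert G) (es : seq (edge G)) : bool :=
  if es is e :: es' then (esrc e == v) && walk (etgt e) es' else true.

(* A path is its initial vertex together with its list of edges, so that the
   paths of length zero are the vertices. *)
Definition gpath := {p : vert G * seq (edge G) | walk p.1 p.2}.

Definition edges (xi : gpath) : seq (edge G) := (val xi).2.
Definition plen (xi : gpath) : nat := size (edges xi).
Definition psrc (xi : gpath) : vert G := (val xi).1.

(* [vtx xi k] is v_k for 0 <= k <= n, with n the length of [xi]. *)
Definition vtx (xi : gpath) (k : nat) : vert G :=
  nth (psrc xi) (psrc xi :: map (@etgt R G) (edges xi)) k.
Definition ptgt (xi : gpath) : vert G := vtx xi (plen xi).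

Lemma walk_rcons v es e :
  walk v (rcons es e) = walk v es && (esrc e == last v (map (@etgt R G) es)).
Proof.
elim: es v => [|e' es IH] v /=; first by rewrite andbT.
by rewrite IH andbA.
Qed.

Lemma walk_rev v es : walk v es ->
  walk (last v (map (@etgt R G) es)) (rev (map (@erev R G) es)).
Proof.
elim: es v => [|e es IH] v //= /andP[/eqP ev wes].
rewrite rev_cons walk_rcons IH //= esrc_erev; apply/eqP.
case: es wes {IH} => [|e' es] //= /andP[/eqP <- _].
by rewrite rev_cons map_rcons last_rcons etgt_erev.
Qed.

Lemma ptgtE xi : ptgt xi = last (psrc xi) (map (@etgt R G) (edges xi)).
Proof. by rewrite (last_nth (psrc xi)) size_map. Qed.

Lemma rev_path_subproof xi : walk (ptgt xi) (rev (map (@erev R G) (edges xi))).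
Proof. by rewrite ptgtE walk_rev //; exact: (valP xi). Qed.

Definition rev_path (xi : gpath) : gpath :=
  Sub (ptgt xi, rev (map (@erev R G) (edges xi))) (rev_path_subproof xi).

(* The direct sum of the P_n is the free complex vector space on all paths, P_n
   being spanned by the paths of length n. *)
Definition pathspace := {malg R[i][gpath]}.

(* The basis vector [xi] of the path given by (v, es); it is 0 if the edges do
   not compose, which only occurs below with a zero coefficient. *)
Definition pvec (v : vert G) (es : seq (edge G)) : pathspace :=
  if insub (v, es) is Some xi then << xi >> else 0.

Definition linext (V : lmodType R[i]) (f : gpath -> V) (x : pathspace) : V :=
  \sum_(xi <- msupp x) x@_xi *: f xi.

Definition bilext (f : gpath -> gpath -> pathspace) (x y : pathspace) :
    pathspace :=
  linext (fun xi => linext (f xi) y) x.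

Definition star (x : pathspace) : pathspace :=
  \sum_(xi <- msupp x) (x@_xi)^* *: << rev_path xi >>.

(* Edges are numbered from 0 here: [edelta xi i eta j] is the Kronecker delta
   comparing the (i+1)-st edge of xi with the reversed (j+1)-st edge of eta. *)
Definition edelta (xi : gpath) (i : nat) (eta : gpath) (j : nat) : R :=
  (onth (edges xi) i == omap (@erev R G) (onth (edges eta) j))%:R.

End Paths.

Arguments pvec {R G}.
Arguments linext {R G V}.
Arguments bilext {R G}.

(* In the sets below the ordinal [i : 'I_n] stands for the point i + 1. *)

Definition noncrossing (X : finType) (pos : X -> nat) (P : {set {set X}}) :=
  [forall B in P, forall C in P,
   forall a in B, forall b in C, forall c in B, forall d in C,
     [&& pos a < pos b, pos b < pos c & pos c < pos d]%N ==> (B == C)].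

Definition nc_pairing (n : nat) (D : {set 'I_n}) (P : {set {set 'I_n}}) :=
  [&& partition P D, [forall B in P, #|B| == 2%N]
    & noncrossing (@nat_of_ord n) P].

Definition TL_rel (n : nat) (T : {set {set 'I_n}}) := nc_pairing [set: 'I_n] T.

Definition refines (X : finType) (P Q : {set {set X}}) :=
  [forall B in P, exists C in Q, B \subset C].

(* The order 1 < 1' < 2 < 2' < ... < n < n'; [inr i] are the primed points. *)
Definition interleave (n : nat) (x : 'I_n + 'I_n) : nat :=
  match x with inl i => i.*2 | inr i => i.*2.+1 end.

Definition interleaved_union (n : nat) (T K : {set {set 'I_n}}) :
    {set {set ('I_n + 'I_n)}} :=
  [set inl @: (B : {set 'I_n}) | B in T] :|:
  [set inr @: (C : {set 'I_n}) | C in K].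

Definition kreweras_compatible (n : nat) (T K : {set {set 'I_n}}) :=
  partition K [set: 'I_n] &&
  noncrossing (@interleave n) (interleaved_union T K).

Definition is_kreweras (n : nat) (T K : {set {set 'I_n}}) :=
  kreweras_compatible T K &&
  [forall K' : {set {set 'I_n}}, kreweras_compatible T K' ==> refines K' K].

(* The largest compatible partition exists whenever [T] is non-crossing. *)
Definition kreweras (n : nat) (T : {set {set 'I_n}}) : {set {set 'I_n}} :=
  odflt set0 [pick K | is_kreweras T K].

(* A diagram from [n]: the set of through-points and the set of caps. *)
Definition diagram (n : nat) := ({set 'I_n} * {set {set 'I_n}})%type.
Definition through (n : nat) (S : diagram n) : {set 'I_n} := S.1.
Definition caps (n : nat) (S : diagram n) : {set {set 'I_n}} := S.2.

Definition epiTL (n m : nat) : {set diagram n} :=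
  [set S : diagram n |
    [&& #|through S| == m, nc_pairing (~: through S) (caps S)
      & [forall B in caps S, forall a in B, forall b in B,
         forall t in through S, ~~ (a < t < b)%N]]].

Definition non_nested (n : nat) (S : diagram n) :=
  [forall B in caps S, forall C in caps S,
   forall a in B, forall b in B, forall c in C, forall d in C,
     ~~ [&& a < c, c < d & d < b]%N].

Section Algebras.
Variables (R : realType) (G : graph R).
Implicit Types (xi eta : gpath G) (x y : pathspace G).

Definition concat_path xi eta : pathspace G :=
  if ptgt xi == psrc eta then pvec (psrc xi) (edges xi ++ edges eta) else 0.

Definition sharp_path xi eta : pathspace G :=
  let m := plen xi in
  let n := plen eta in
  if ptgt xi == psrc eta then
    \sum_(k < (minn m n).+1)
      ((\prod_(i < k) edelta xi (m - i.+1) eta i) *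
       (mu (ptgt xi) / mu (vtx xi (m - k))))%:C *:
      pvec (psrc xi) (take (m - k) (edges xi) ++ drop k (edges eta))
  else 0.

(* v_C: the vertex v_c for a representative c of the block C. *)
Definition block_vertex xi (n : nat) (C : {set 'I_n}) : vert G :=
  if [pick c in C] is Some c then vtx xi c.+1 else psrc xi.

Definition tau_TL xi (T : {set {set 'I_(plen xi)}}) : R :=
  (\prod_(ij : 'I_(plen xi) * 'I_(plen xi) |
          (ij.1 < ij.2)%N && ([set ij.1; ij.2] \in T))
     edelta xi ij.1 xi ij.2) *
  \prod_(C in kreweras T) mu (block_vertex xi C) ^ (2 - #|C|%:Z).

Definition tau_path xi : R[i] :=
  (if plen xi == 0%N then mu (psrc xi) ^+ 2
   else \sum_(T : {set {set 'I_(plen xi)}} | TL_rel T) tau_TL T)%:C.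

Definition t_path xi : R[i] :=
  (if plen xi == 0%N then mu (psrc xi) ^+ 2 else 0)%:C.

(* The image of [xi] under S. If the product of deltas does not vanish, the
   through-edges compose to a path, whose initial vertex is that of the first
   of them. *)
Definition diagram_act xi (S : diagram (plen xi)) : pathspace G :=
  let es := pmap (fun t : 'I_(plen xi) => onth (edges xi) t)
                 (enum (through S)) in
  (\prod_(ij : 'I_(plen xi) * 'I_(plen xi) |
          (ij.1 < ij.2)%N && ([set ij.1; ij.2] \in caps S))
     (edelta xi ij.1 xi ij.2 *
      (mu (vtx xi ij.1.+1) / mu (vtx xi ij.2.+1))))%:C *:
  pvec (head (ptgt xi) (map (@esrc R G) es)) es.

Definition phi_path (m : nat) xi : pathspace G :=
  \sum_(S in epiTL (plen xi) m) diagram_act S.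

Definition psi_path (m : nat) xi : pathspace G :=
  (-1) ^+ ((plen xi - m)./2) *:
  \sum_(S in epiTL (plen xi) m | non_nested S) diagram_act S.

End Algebras.

(* Only the data are recorded, not the laws. *)
Record star_algebra (R : realType) := StarAlgebra {
  carrier :> lmodType R[i];
  amul : carrier -> carrier -> carrier;
  astar : carrier -> carrier
}.

Definition star_isomorphism (R : realType) (A B : star_algebra R)
    (f : A -> B) : Prop :=
  [/\ linear f,
      forall x y, f (amul x y) = amul (f x) (f y),
      forall x, f (astar x) = astar (f x)
    & bijective f].

Definition Gr (R : realType) (G : graph R) : star_algebra R :=
  @StarAlgebra R (pathspace G) (bilext (@concat_path R G)) (@star R G).

Definition Fock (R : realType) (G : graph R) : star_algebra R :=
  @StarAlgebra R (pathspace G) (bilext (@sharp_path R G)) (@star R G).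

Definition tau (R : realType) (G : graph R) : Gr G -> R[i] :=
  linext (V := R[i]^o) (@tau_path R G).

Definition fock_t (R : realType) (G : graph R) : Fock G -> R[i] :=
  linext (V := R[i]^o) (@t_path R G).

Definition phi (R : realType) (G : graph R) : Gr G -> Fock G :=
  linext (fun xi : gpath G => \sum_(m < (plen xi).+1) phi_path m xi).

Definition psi (R : realType) (G : graph R) : Fock G -> Gr G :=
  linext (fun xi : gpath G => \sum_(m < (plen xi).+1) psi_path m xi).

(* Main.v *)
From HB Require Import structures.
Require Import Defs.
From mathcomp Require Import all_boot all_order all_algebra.
From mathcomp Require Import zify.
From mathcomp Require Import finmap reals complex.
From mathcomp.multinomials Require Import monalg.

Set Implicit Arguments.
Unset Strict Implicit.
Unset Printing Implicit Defensive.

Import Order.TTheory GRing.Theory Num.Theory.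
Local Open Scope ring_scope.

(* For an edge e let L_e be the left #-multiplication by the path e, which is a
   creation operator plus an annihilation operator.  Sorting the diagrams
   according to what happens to the first bottom point (it is a through-point,
   or it is capped with the first through-point of the remaining diagram) gives
   phi (e o xi) = L_e (phi xi).  For non-nested diagrams a capped first point is
   capped with its neighbour, and the signs turn this into psi (L_e x) = e o psi x.
   These two recursions make phi and psi mutually inverse.  As L_e commutes with
   right #-multiplication, the first one also makes phi multiplicative; and since
   (L_e x)^* = x^* # [reverse of e], multiplicativity makes phi compatible with *.
   For the functionals, the blocks of the Kreweras complement of T are the regions
   cut out by the caps.  All vertices of a region agree when the deltas do not
   vanish, and each region except the outer one contains exactly one left end of
   a cap, so the two weights have the same factors. *)

(** * Diagrams as non-crossing involutions *)

Section Partner.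
Variable n : nat.
Implicit Types (p : {ffun 'I_n -> 'I_n}) (S : diagram n).

(* A diagram is encoded by the involution exchanging the ends of each cap and
   fixing the through-points. *)
Definition ncinv p :=
  [forall i, p (p i) == i] &&
  [forall i : 'I_n, forall j : 'I_n, (i < j < p i)%N ==>
    [&& p j != j, i < p j & p j < p i]%N].

Lemma ncinvP p : reflect
  (involutive p /\
   forall i j : 'I_n, (i < j < p i)%N -> [&& p j != j, i < p j & p j < p i]%N)
  (ncinv p).
Proof.
apply: (iffP andP) => -[h1 h2]; split.
- by move=> i; apply/eqP; exact: (forallP h1).
- by move=> i j; apply/implyP; exact: (forallP (forallP h2 i)).
- by apply/forallP => i; rewrite h1.
- by apply/'forall_forallP => i j; apply/implyP; exact: h2.
Qed.

Definition diagram_of p : diagram n :=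
  ([set i | p i == i], [set [set i; p i] | i in [set i | p i != i]]).

Definition is_epi S :=
  nc_pairing (~: through S) (caps S) &&
  [forall B in caps S, forall a in B, forall b in B,
     forall t in through S, ~~ (a < t < b)%N].

Lemma mem_epiTL m S : (S \in epiTL n m) = (#|through S| == m) && is_epi S.
Proof. by rewrite inE. Qed.

Definition mate S (i j : 'I_n) := (i != j) && ([set i; j] \in caps S).

(** The default [i] turns through-points into fixed points; on epi-TL diagrams this is the inverse
    of [diagram_of]. *)
Definition partner S : {ffun 'I_n -> 'I_n} :=
  [ffun i => odflt i [pick j | mate S i j]].

Lemma mate_sym S i j : mate S i j = mate S j i.
Proof. by rewrite /mate eq_sym setUC. Qed.

Section Epi.
Variable S : diagram n.
Hypothesis epiS : is_epi S.

Let parS : partition (caps S) (~: through S).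
Proof. by case/andP: epiS => /and3P[]. Qed.

Lemma caps_pair B : B \in caps S -> exists i j, mate S i j /\ B = [set i; j].
Proof.
case/andP: (epiS) => /and3P[_ /forall_inP c2 _] _ BS.
have /cards2P [x [y [xy eB]]] := c2 _ BS.
by exists x, y; rewrite /mate xy -eB.
Qed.

Lemma mate_uniq i j k : mate S i j -> mate S i k -> j = k.
Proof.
move=> /andP[ij ijS] /andP[ik ikS].
case/and3P: parS => _ tI _.
have /setP/(_ j) : [set i; j] = [set i; k].
  by rewrite -(def_pblock tI ijS (set21 i j)) -(def_pblock tI ikS (set21 i k)).
by rewrite !inE eqxx orbT eq_sym (negbTE ij) /= => /esym/eqP.
Qed.

Lemma mate_through i j : mate S i j -> i \notin through S.
Proof.
move=> /andP[_ ijS]; rewrite -in_setC -(cover_partition parS).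
by apply/bigcupP; exists [set i; j] => //; rewrite set21.
Qed.

Lemma mate_ex i : i \notin through S -> exists j, mate S i j.
Proof.
rewrite -in_setC -(cover_partition parS) => /bigcupP[B /caps_pair].
case=> x [y [mxy ->]]; rewrite !inE => /orP[] /eqP ->; first by exists y.
by exists x; rewrite mate_sym.
Qed.

Lemma mate_nc a b c d : mate S a c -> mate S b d -> (a < b < c)%N ->
  ~~ (c < d)%N.
Proof.
move=> mac mbd /andP[ab bc]; apply/negP => cd.
case/andP: (epiS) => /and3P[_ _] nc _.
have /andP[ac acS] := mac; have /andP[bd bdS] := mbd.
move/forall_inP/(_ _ acS)/forall_inP/(_ _ bdS): nc.
move/forall_inP/(_ a (set21 _ _))/forall_inP/(_ b (set21 _ _)).
move/forall_inP/(_ c (set22 _ _))/forall_inP/(_ d (set22 _ _)).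
(* Non-crossing forces the two caps to coincide, so [a] would be [b] or [d], against the strict
   order. *)
rewrite ab bc cd /= => /eqP/setP/(_ a); rewrite !inE eqxx /=.
by case/esym/orP => /eqP E; move: ab bc cd; rewrite E; lia.
Qed.

Lemma mate_cover a b t : mate S a b -> t \in through S -> ~~ (a < t < b)%N.
Proof.
move=> /andP[_ abS] tS; case/andP: (epiS) => _ h.
move/forall_inP/(_ _ abS)/forall_inP/(_ a (set21 _ _)): h.
by move/forall_inP/(_ b (set22 _ _))/forall_inP/(_ _ tS).
Qed.

Lemma partner_mate i j : mate S i j -> partner S i = j.
Proof.
move=> m; rewrite ffunE; case: pickP => [k /mate_uniq/(_ m)//|/(_ j)].
by rewrite m.
Qed.

Lemma partner_through i : i \in through S -> partner S i = i.
Proof.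
move=> iS; rewrite ffunE; case: pickP => //= k /mate_through.
by rewrite iS.
Qed.

(** The condition on a point under a cap combines both planarity conditions: no through-point lies
    under a cap, and caps do not cross. *)
Lemma partner_ncinv : ncinv (partner S).
Proof.
apply/ncinvP; split=> [i|i j].
  have [iS|/mate_ex [j m]] := boolP (i \in through S).
    by rewrite !partner_through.
  by rewrite (partner_mate m); apply: partner_mate; rewrite mate_sym.
have [/partner_through -> |/mate_ex [k m]] := boolP (i \in through S).
  by lia.
rewrite (partner_mate m) => h.
have [/(mate_cover m)|/mate_ex [l ml]] := boolP (j \in through S).
  by rewrite h.
rewrite (partner_mate ml); have /andP[jl _] := ml.
have lk : l != k.
  apply: contraTneq h => lk; move: ml m; rewrite lk mate_sym => ml.
  by rewrite mate_sym => /(mate_uniq ml) ->; rewrite ltnn.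
have li : l != i.
  apply: contraTneq h => li; move: ml; rewrite li mate_sym => /(mate_uniq m) ->.
  by rewrite ltnn andbF.
have := mate_nc m ml h.
(* If [l] were left of [i], the cap from [l] to [j] would cross the cap from [i] to [k]. *)
have : (l < i)%N -> ~~ (i < k)%N || ~~ (i < j)%N || ~~ (j < k)%N.
  move=> h'; move: ml; rewrite mate_sym => ml.
  by have := mate_nc ml m; lia.
by move: h jl lk li; rewrite -!val_eqE /=; lia.
Qed.

Lemma partnerK : diagram_of (partner S) = S.
Proof.
rewrite /diagram_of; case: S epiS mate_ex partner_mate partner_through caps_pair.
move=> T C eS ex pm pt cp; congr pair.
  apply/setP => i; rewrite inE; apply/eqP/idP => [|/pt //].
  apply: contra_eqT => /ex [j m]; rewrite (pm _ _ m).
  by rewrite eq_sym; case/andP: m.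
apply/setP => B; apply/imsetP/idP => [[k]|/cp [i [j [m ->]]]].
  rewrite inE; have [/pt -> /eqP //|/ex [j m] _ ->] := boolP (k \in T).
  by rewrite (pm _ _ m); case/andP: m.
exists i; rewrite ?inE (pm _ _ m) //.
by rewrite eq_sym; case/andP: m.
Qed.

End Epi.

Section Diagram.
Variable p : {ffun 'I_n -> 'I_n}.
Hypothesis ncp : ncinv p.

Let pK : involutive p.
Proof. by case/ncinvP: ncp. Qed.

Lemma ncinv_inj i j : (p i == p j) = (i == j).
Proof. exact: inj_eq (can_inj pK) _ _. Qed.

Lemma capsP B : reflect (exists2 i, p i != i & B = [set i; p i])
  (B \in caps (diagram_of p)).
Proof.
apply: (iffP imsetP) => -[k]; rewrite ?inE => pk ->; exists k => //.
by rewrite inE.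
Qed.

(** The caps are orbits of the involution [p], so either end generates the block. *)
Lemma cap_block i j : i \in [set j; p j] -> [set j; p j] = [set i; p i].
Proof. by rewrite !inE => /orP[] /eqP -> //; rewrite pK setUC. Qed.

Lemma caps_pair_partner a b :
  ([set a; b] \in caps (diagram_of p)) = (p a != a) && (b == p a).
Proof.
apply/capsP/andP => [[i pi E]|[pa /eqP ->]]; last by exists a.
have /cap_block Ea : a \in [set i; p i] by rewrite -E set21.
have /setP/(_ (p a)) : [set a; b] = [set a; p a] by rewrite E.
have pa : p a != a.
  have : a \in [set i; p i] by rewrite -E set21.
  by rewrite !inE => /orP[] /eqP -> //; rewrite pK eq_sym.
by rewrite !inE eqxx !orbT (negbTE pa) /= => e; rewrite eq_sym e.
Qed.

Lemma cap_lt a b B : B \in caps (diagram_of p) -> a \in B -> b \in B ->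
  (a < b)%N -> b = p a.
Proof.
case/capsP => i _ -> /cap_block ->; rewrite !inE => /orP[] /eqP -> //.
by rewrite ltnn.
Qed.

Lemma diagram_of_epi : is_epi (diagram_of p).
Proof.
have [_ nc] := ncinvP _ ncp.
apply/andP; split; last first.
  apply/forall_inP => B BS; apply/forall_inP => a aB; apply/forall_inP => b bB.
  apply/forall_inP => t; rewrite inE => tp; apply/negP => /andP[ta tb].
  have ab := ltn_trans ta tb.
  by have := nc a t; rewrite -(cap_lt BS aB bB ab) ta tb tp => /(_ isT).
apply/and3P; split.
- apply/and3P; split.
  + apply/eqP/setP => i; apply/bigcupP/idP => [[B /capsP[j pj ->]]|].
      by rewrite !inE => /orP[] /eqP -> //; rewrite ncinv_inj.
    rewrite !inE => pi; exists [set i; p i]; rewrite ?set21 //.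
    by apply/capsP; exists i.
  + apply/trivIsetP => B C /capsP[i _ ->] /capsP[j _ ->].
    apply: contraR => /pred0Pn [k /= /andP[/cap_block -> /cap_block ->]].
    exact: eqxx.
  + by apply/capsP => -[i _ /setP/(_ i)]; rewrite !inE eqxx.
- apply/forall_inP => B /capsP[i pi ->].
  by rewrite cards2 (eq_sym i) pi.
apply/forall_inP => B BS; apply/forall_inP => C CS.
apply/forall_inP => a aB; apply/forall_inP => b bC.
apply/forall_inP => c cB; apply/forall_inP => d dC.
apply/implyP => /and3P[ab bc cd]; exfalso.
have ac := ltn_trans ab bc; have bd := ltn_trans bc cd.
have := nc a b; rewrite -(cap_lt BS aB cB ac) -(cap_lt CS bC dC bd).
by rewrite ab bc => /(_ isT) /and3P[_ _]; move: cd; lia.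
Qed.

Lemma diagram_ofK : partner (diagram_of p) = p.
Proof.
apply/ffunP => i; have [pi|pi] := eqVneq (p i) i.
  by rewrite partner_through ?pi // ?inE ?pi //; exact: diagram_of_epi.
apply: partner_mate; first exact: diagram_of_epi.
by rewrite /mate caps_pair_partner pi eqxx eq_sym pi.
Qed.

End Diagram.

(** Moves sums over diagrams to sums over involutions, where points are easily added and removed. *)
Lemma sum_epi (V : nmodType) (P : pred (diagram n)) (F : diagram n -> V) :
  \sum_(S | is_epi S && P S) F S =
  \sum_(p | ncinv p && P (diagram_of p)) F (diagram_of p).
Proof.
rewrite (reindex_onto diagram_of partner); last first.
  by move=> S /andP[/partnerK].
apply: eq_bigl => p; apply/idP/idP => [/andP[/andP[eS ->] /eqP <-]|/andP[ncp ->]].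
  by rewrite partner_ncinv.
by rewrite diagram_of_epi //= diagram_ofK.
Qed.

End Partner.

(** * Removing the first bottom point *)

Section Recursion.
Variable n : nat.
Implicit Types (p : {ffun 'I_n -> 'I_n}) (q : {ffun 'I_n.+1 -> 'I_n.+1}).

Local Notation up := (lift (@ord0 n)).

Definition add_through p : {ffun 'I_n.+1 -> 'I_n.+1} :=
  [ffun i => if unlift ord0 i is Some j then up (p j) else ord0].

(** Meant for a free point [k] of [p], which becomes the right end of a cap starting at the new
    first point. *)
Definition add_cap p k : {ffun 'I_n.+1 -> 'I_n.+1} :=
  [ffun i => if unlift ord0 i is Some j then
               if j == k then ord0 else up (p j)
             else up k].

(** Undoes both constructions: a point that [q] joins to [ord0] gets the default value and becomes
    free. *)
Definition down q : {ffun 'I_n -> 'I_n} :=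
  [ffun i => odflt i (unlift ord0 (q (up i)))].

Definition first_fixed p k :=
  (p k == k) && [forall i : 'I_n, (i < k)%N ==> (p i != i)].

Lemma add_through0 p : add_through p ord0 = ord0.
Proof. by rewrite ffunE unlift_none. Qed.

Lemma add_through_lift p i : add_through p (up i) = up (p i).
Proof. by rewrite ffunE liftK. Qed.

Lemma add_cap0 p k : add_cap p k ord0 = up k.
Proof. by rewrite ffunE unlift_none. Qed.

Lemma add_cap_lift p k i :
  add_cap p k (up i) = if i == k then ord0 else up (p i).
Proof. by rewrite ffunE liftK. Qed.

Lemma lift0_inj : injective up.
Proof. exact: lift_inj. Qed.

Lemma lift0_eq0 i : (up i == ord0) = false.
Proof. by rewrite eq_sym; apply/negbTE/neq_lift. Qed.

Lemma lift0_case (P : 'I_n.+1 -> Prop) :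
  P ord0 -> (forall i, P (up i)) -> forall i, P i.
Proof. by move=> P0 Pl i; case: (unliftP ord0 i) => [j|] ->. Qed.

Lemma ncinv_add_through p : ncinv (add_through p) = ncinv p.
Proof.
apply/ncinvP/ncinvP => -[pK nc]; split.
- by move=> i; apply: lift0_inj; rewrite -!add_through_lift pK.
- move=> i j h; have := nc (up i) (up j).
  by rewrite !add_through_lift !lift0 !ltnS (inj_eq lift0_inj); exact.
- by elim/lift0_case => [|i]; rewrite ?add_through0 ?add_through_lift ?pK.
- elim/lift0_case => [|i] j; first by rewrite add_through0; lia.
  elim/lift0_case: j => [|j]; first by rewrite ltn0.
  rewrite !add_through_lift !lift0 !ltnS (inj_eq lift0_inj); exact: nc.
Qed.

(** No through-point may lie under the new cap, so [k] is the first one. Conversely, caps of [p]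
    cannot pass over the through-point [k], so none crosses the new cap. *)
Lemma ncinv_add_cap p k : p k = k ->
  ncinv (add_cap p k) = ncinv p && first_fixed p k.
Proof.
move=> pk; apply/ncinvP/andP => [[qK nc]|[/ncinvP[pK nc] /andP[_ /forallP fk]]].
  (* Otherwise [up i] would go to [up k] and then to [ord0], so [add_cap p k] would not be an
     involution. *)
  have lk i : i != k -> p i != k.
    move=> ik; apply: contraTneq (isT) => pik.
    have := qK (up i); rewrite add_cap_lift (negbTE ik) pik add_cap_lift eqxx.
    by move/eqP; rewrite eq_sym lift0_eq0.
  split; last first.
    rewrite /first_fixed pk eqxx; apply/forallP => i; apply/implyP => ik.
    have := nc ord0 (up i); rewrite add_cap0 add_cap_lift !lift0 !ltnS.
    have -> : (i == k) = false by apply/negbTE; rewrite -val_eqE /=; lia.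
    by rewrite ik (inj_eq lift0_inj) => /(_ isT) /andP[].
  apply/ncinvP; split=> [i|i j].
    have [->|ik] := eqVneq i k; first by rewrite !pk.
    have := qK (up i); rewrite !add_cap_lift (negbTE ik) add_cap_lift.
    by rewrite (negbTE (lk _ ik)) => /lift0_inj.
  have [->|ik] := eqVneq i k; first by rewrite pk; lia.
  have := nc (up i) (up j); rewrite !add_cap_lift (negbTE ik).
  have [->|jk] := eqVneq j k; first by rewrite !lift0 !ltnS => h /h; rewrite andbF.
  by rewrite !lift0 !ltnS (inj_eq lift0_inj).
have lk i : i != k -> p i != k.
  by move=> ik; apply: contra_neq ik => e; rewrite -(pK i) e pk.
split.
  elim/lift0_case => [|i]; first by rewrite add_cap0 add_cap_lift eqxx.
  rewrite add_cap_lift; have [->|ik] := eqVneq i k; first by rewrite add_cap0.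
  by rewrite add_cap_lift (negbTE (lk _ ik)) pK.
elim/lift0_case => [|i] j.
  rewrite add_cap0; elim/lift0_case: j => [|j]; first by rewrite ltnn.
  rewrite add_cap_lift !lift0 !ltnS => /andP[_ jk].
  have := fk j; rewrite jk /= => pj.
  have nk : j != k by rewrite -val_eqE /=; lia.
  rewrite (negbTE nk) lift0 (inj_eq lift0_inj) pj /=.
  have := lk _ nk; rewrite -val_eqE /= => pjk.
  (* A cap starting at [j] cannot pass over the through-point [k], so it ends before [k]. *)
  have := nc j k; rewrite jk pk eqxx /=; lia.
rewrite add_cap_lift; have [->|ik] := eqVneq i k; first by rewrite ltn0 andbF.
elim/lift0_case: j => [|j]; first by rewrite ltn0.
rewrite !add_cap_lift !lift0 !ltnS => h.
have [jk|jk] := eqVneq j k.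
  by have := nc i k; rewrite -jk h jk pk eqxx => /(_ isT).
rewrite !lift0 !ltnS (inj_eq lift0_inj); exact: nc.
Qed.

Lemma add_through_down q : q ord0 = ord0 -> ncinv q -> add_through (down q) = q.
Proof.
move=> q0 /ncinvP[qK _]; apply/ffunP; elim/lift0_case => [|i].
  by rewrite add_through0 q0.
rewrite add_through_lift ffunE; case: (unliftP ord0 (q (up i))) => [j -> //|e].
by have := qK (up i); rewrite e q0 => /eqP; rewrite eq_sym lift0_eq0.
Qed.

Lemma add_cap_down q k : q ord0 = up k -> ncinv q -> add_cap (down q) k = q.
Proof.
move=> q0 /ncinvP[qK _]; apply/ffunP; elim/lift0_case => [|i].
  by rewrite add_cap0 q0.
rewrite add_cap_lift ffunE; have [->|ik] := eqVneq i k; first by rewrite -q0 qK.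
case: (unliftP ord0 (q (up i))) => [j -> //|e].
have := qK (up i); rewrite e q0 => /lift0_inj e'.
by rewrite e' eqxx in ik.
Qed.

Lemma down_add_through p : down (add_through p) = p.
Proof. by apply/ffunP => i; rewrite ffunE add_through_lift liftK. Qed.

(** A boolean equation because it is the side condition left by reindexing along [add_cap]. *)
Lemma down_add_cap p k : (down (add_cap p k) == p) = (p k == k).
Proof.
apply/eqP/eqP => [<-|pk]; first by rewrite ffunE add_cap_lift eqxx unlift_none.
apply/ffunP => i; rewrite ffunE add_cap_lift.
by have [->|ik] := eqVneq i k; rewrite ?unlift_none ?liftK ?pk.
Qed.

(** Sorts the involutions by the image of the first point: itself, or [up k]. *)
Lemma sum_ncinvS (V : nmodType) (P : pred {ffun 'I_n.+1 -> 'I_n.+1})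
    (F : {ffun 'I_n.+1 -> 'I_n.+1} -> V) :
  \sum_(q | ncinv q && P q) F q =
  \sum_(p | ncinv p && P (add_through p)) F (add_through p) +
  \sum_k \sum_(p | ncinv p && first_fixed p k && P (add_cap p k)) F (add_cap p k).
Proof.
rewrite (partition_big (fun q => q ord0) xpredT) //= big_ord_recl; congr (_ + _).
  rewrite (reindex_onto add_through down) => [|q /andP[/andP[ncq _] /eqP q0]]; last first.
    exact: add_through_down.
  apply: eq_bigl => p.
  by rewrite ncinv_add_through add_through0 down_add_through !eqxx !andbT.
apply: eq_bigr => k _.
rewrite (reindex_onto (add_cap^~ k) down) => [|q /andP[/andP[ncq _] /eqP q0]]; last first.
  exact: add_cap_down.
apply: eq_bigl => p; rewrite add_cap0 eqxx down_add_cap !andbT.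
have [pk|pk] := eqVneq (p k) k; first by rewrite ncinv_add_cap // andbT.
by rewrite /first_fixed (negbTE pk) !andbF.
Qed.

(** An increasing list, so that the first through-point is its head and the through-edges come out
    in order. *)
Definition fixed_points m (p : {ffun 'I_m -> 'I_m}) :=
  [seq i <- enum 'I_m | p i == i].

Lemma mem_fixed_points m (p : {ffun 'I_m -> 'I_m}) i :
  (i \in fixed_points p) = (p i == i).
Proof. by rewrite mem_filter mem_enum andbT. Qed.

Lemma enum_through m (p : {ffun 'I_m -> 'I_m}) :
  enum (through (diagram_of p)) = fixed_points p.
Proof.
rewrite {1}/enum_mem -enumT /fixed_points; apply: eq_filter => i.
by rewrite !inE.
Qed.

Lemma fixed_points_sorted m (p : {ffun 'I_m -> 'I_m}) :
  sorted (fun i j : 'I_m => i < j)%N (fixed_points p).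
Proof.
apply: sorted_filter; first by move=> ? ? ?; exact: ltn_trans.
have := iota_ltn_sorted 0 m; rewrite -val_enum_ord sorted_map; exact.
Qed.

Lemma first_fixed_cons p k r : fixed_points p = k :: r ->
  forall l, first_fixed p l = (l == k).
Proof.
move=> E; have /= := fixed_points_sorted p; rewrite E => /= ps.
have lt_k i : p i == i -> i != k -> (k < i)%N.
  rewrite -mem_fixed_points E inE => /predU1P[-> /eqP //|ir _].
  have /allP := order_path_min (fun _ _ _ => @ltn_trans _ _ _) ps.
  exact.
have pk : p k == k by rewrite -mem_fixed_points E mem_head.
move=> l; apply/idP/eqP => [/andP[pl /forallP fl]|->].
  apply: contraTeq isT => lk.
  by have := fl k; rewrite (lt_k _ pl lk) pk.
rewrite /first_fixed pk; apply/forallP => i; apply/implyP => ik.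
by apply: contraTN ik => pi; have [->|/(lt_k _ pi)] := eqVneq i k; lia.
Qed.

Lemma first_fixed_nil p k : fixed_points p = [::] -> first_fixed p k = false.
Proof.
move=> E; apply/negbTE; rewrite /first_fixed negb_and.
by rewrite -mem_fixed_points E.
Qed.

Lemma fixed_points_add_through p :
  fixed_points (add_through p) = ord0 :: map up (fixed_points p).
Proof.
rewrite /fixed_points enum_ordSl /= add_through0 eqxx filter_map; congr (_ :: map _ _).
by apply: eq_filter => i /=; rewrite add_through_lift (inj_eq lift0_inj).
Qed.

Lemma fixed_points_add_cap p k r : fixed_points p = k :: r ->
  fixed_points (add_cap p k) = map up r.
Proof.
move=> E.
have ur : uniq (k :: r) by rewrite -E filter_uniq // enum_uniq.
rewrite /fixed_points enum_ordSl /= add_cap0 lift0_eq0 filter_map; congr (map _ _).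
(* Deleting the head of a duplicate-free list is filtering by [!= k], so both sides become filters
   of the same enumeration. *)
transitivity (rem k (k :: r)); last by rewrite /= eqxx.
rewrite rem_filter // -E /fixed_points -filter_predI; apply: eq_filter => i /=.
rewrite add_cap_lift; case: (i == k) => /=; first by rewrite eq_sym lift0_eq0.
by rewrite (inj_eq lift0_inj).
Qed.

Lemma non_nestedP m (p : {ffun 'I_m -> 'I_m}) : ncinv p -> reflect
  (forall i j : 'I_m, ~~ [&& i < j, j < p j & p j < p i]%N)
  (non_nested (diagram_of p)).
Proof.
move=> ncp; apply: (iffP idP) => [nn i j|nn].
  apply/negP => /and3P[ij jp pp].
  have iS : [set i; p i] \in caps (diagram_of p).
    by rewrite caps_pair_partner // eqxx andbT -val_eqE /=; lia.
  have jS : [set j; p j] \in caps (diagram_of p).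
    by rewrite caps_pair_partner // eqxx andbT -val_eqE /=; lia.
  move/forall_inP/(_ _ iS)/forall_inP/(_ _ jS): nn.
  move/forall_inP/(_ _ (set21 _ _))/forall_inP/(_ _ (set22 _ _)).
  move/forall_inP/(_ _ (set21 _ _))/forall_inP/(_ _ (set22 _ _)).
  by rewrite ij jp pp.
apply/forall_inP => B BS; apply/forall_inP => C CS.
apply/forall_inP => a aB; apply/forall_inP => b bB.
apply/forall_inP => c cC; apply/forall_inP => d dC.
apply/negP => /and3P[ac cd db].
have ab : (a < b)%N by lia.
have := nn a c; rewrite -(cap_lt ncp BS aB bB ab) -(cap_lt ncp CS cC dC cd).
by rewrite ac cd db.
Qed.

Lemma non_nested_add_through p : ncinv p ->
  non_nested (diagram_of (add_through p)) = non_nested (diagram_of p).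
Proof.
move=> ncp; have ncq : ncinv (add_through p) by rewrite ncinv_add_through.
apply/(non_nestedP ncq)/(non_nestedP ncp) => nn.
  move=> i j; have := nn (up i) (up j).
  by rewrite !add_through_lift !lift0 !ltnS.
elim/lift0_case => [|i] j; first by rewrite add_through0 ltn0 !andbF.
elim/lift0_case: j => [|j]; first by rewrite ltn0.
by rewrite !add_through_lift !lift0 !ltnS.
Qed.

(** All points left of the first through-point [k] are capped among themselves, so the new cap has
    nothing below it only if there are no such points. *)
Lemma non_nested_add_cap p k : ncinv p -> first_fixed p k ->
  non_nested (diagram_of (add_cap p k)) =
  non_nested (diagram_of p) && (k == 0 :> nat).
Proof.
move=> ncp /[dup] fk /andP[/eqP pk /forallP lk].
have ncq : ncinv (add_cap p k) by rewrite ncinv_add_cap // ncp.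
have [pK nc] := ncinvP _ ncp.
apply/(non_nestedP ncq)/andP => [nn|[/(non_nestedP ncp) nn /eqP k0]].
  split.
    apply/(non_nestedP ncp) => i j; have := nn (up i) (up j).
    rewrite !add_cap_lift; have [->|ik] := eqVneq i k.
      by rewrite pk; have := nc k (p j); lia.
    have [->|jk] := eqVneq j k; first by rewrite pk ltnn /= !andbF.
    by rewrite !lift0 !ltnS.
  apply: contraT; rewrite -lt0n => k0.
  have n0 : (0 < n)%N by exact: leq_ltn_trans (ltn_ord k).
  (* The first point of [p] lies left of [k]; its cap ends before [k] and is therefore nested in the
     new one. *)
  pose o := Ordinal n0.
  have := nn ord0 (up o); have := lk o; rewrite k0 /= => po.
  have ok : o != k by rewrite -val_eqE /=; lia.
  rewrite add_cap0 add_cap_lift (negbTE ok) !lift0 !ltnS /=.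
  have : p o != k by apply: contra_neq ok => e; rewrite -(pK o) e pk.
  have := nc o k; rewrite pk eqxx /=.
  by move: po; rewrite -!val_eqE /= /bump; lia.
elim/lift0_case => [|i] j.
  elim/lift0_case: j => [|j]; first by rewrite ltnn.
  by rewrite add_cap0 !lift0; apply/negP => /and3P[_]; lia.
elim/lift0_case: j => [|j]; first by rewrite ltn0.
rewrite !add_cap_lift; have [->|ik] := eqVneq i k; first by rewrite ltn0 !andbF.
have [->|jk] := eqVneq j k; first by rewrite ltn0 !andbF.
by rewrite !lift0 !ltnS.
Qed.

End Recursion.

(** * Linear maps on the path space; creation and annihilation *)

Section LinearExtension.
Variables (R : realType) (G : graph R).
Local Notation C := R[i]%C.
Implicit Types (x y : pathspace G) (v : vert G) (es : seq (edge G)).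

(** Allows sums with different supports to be added over a common index set. *)
Lemma linextEw (V : lmodType C) (f : gpath G -> V) x (D : {fset gpath G}) :
  (msupp x `<=` D)%fset -> linext f x = \sum_(xi <- D) x@_xi *: f xi.
Proof.
move=> sD; rewrite /linext; apply: big_fset_incl => // xi _ xiN.
by rewrite (mcoeff_outdom xiN) scale0r.
Qed.

Lemma linext_is_linear (V : lmodType C) (f : gpath G -> V) : linear (linext f).
Proof.
move=> a x y; set D := (msupp x `|` msupp y)%fset.
rewrite !(@linextEw _ _ _ D) ?fsubsetUl ?fsubsetUr //; last first.
  apply: fsubset_trans (msuppD_le _ _) _.
  by apply: fsetUSS; [exact: msuppZ_le | exact: fsubset_refl].
rewrite scaler_sumr -big_split; apply: eq_bigr => xi _ /=.
by rewrite mcoeffD mcoeffZ scalerDl scalerA.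
Qed.

HB.instance Definition _ (V : lmodType C) (f : gpath G -> V) :=
  GRing.isLinear.Build C (pathspace G) V *:%R (linext f) (linext_is_linear f).

Lemma linext_basis (V : lmodType C) (f : gpath G -> V) xi :
  linext f (<< xi >> : pathspace G) = f xi.
Proof. by rewrite /linext msuppU oner_eq0 big_seq_fset1 mcoeffUU scale1r. Qed.

Lemma pathspaceE x : x = \sum_(xi <- msupp x) x@_xi *: (<< xi >> : pathspace G).
Proof.
rewrite {1}[x]monalgE; apply: eq_bigr => xi _.
apply/malgP => k; rewrite mcoeffZ [LHS]mcoeffU [X in _ = _ * X]mcoeffU.
by rewrite mulrnAr mulr1.
Qed.

Lemma pvecE v es (w : walk v es) : pvec v es = << Sub (v, es) w >>.
Proof. by rewrite /pvec insubT. Qed.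

Lemma pvec_nwalk v es : ~~ walk v es -> pvec v es = 0.
Proof. by move=> w; rewrite /pvec insubN. Qed.

Lemma basis_pvec (xi : gpath G) : << xi >> = pvec (psrc xi) (edges xi).
Proof.
by case: xi => -[v es] w /=; rewrite pvecE; congr << _ >>.
Qed.

(** Linearity is a plain hypothesis, so that composites can be compared on paths without declaring a
    structure for each of them. *)
Lemma linear_eq (V : lmodType C) (f g : pathspace G -> V) :
  linear f -> linear g ->
  (forall v es, walk v es -> f (pvec v es) = g (pvec v es)) -> f =1 g.
Proof.
move=> lf lg fg x.
pose f' := HB.pack_for {linear pathspace G -> V} f
  (GRing.isLinear.Build C (pathspace G) V *:%R f lf).
pose g' := HB.pack_for {linear pathspace G -> V} g
  (GRing.isLinear.Build C (pathspace G) V *:%R g lg).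
change (f' x = g' x); rewrite (pathspaceE x) !linear_sum; apply: eq_bigr => xi _.
rewrite !linearZZ /=; congr (_ *: _); rewrite basis_pvec fg //.
exact: valP xi.
Qed.

Definition plin (V : lmodType C) (F : vert G -> seq (edge G) -> V) :=
  linext (fun xi => F (psrc xi) (edges xi)).

HB.instance Definition _ (V : lmodType C) (F : vert G -> seq (edge G) -> V) :=
  GRing.isLinear.Build C (pathspace G) V *:%R (plin F)
    (linext_is_linear (fun xi => F (psrc xi) (edges xi))).

Lemma plin_pvec (V : lmodType C) (F : vert G -> seq (edge G) -> V) v es :
  walk v es -> plin F (pvec v es) = F v es.
Proof. by move=> w; rewrite pvecE /plin linext_basis. Qed.

Definition creation (e : edge G) : pathspace G -> pathspace G :=
  plin (fun v es => if v == etgt e then pvec (esrc e) (e :: es) else 0).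

(** The delta makes [b] run backwards along [e]; hence [v] is [etgt e] and the remaining path starts
    at [esrc e]. *)
Definition annihilation (e : edge G) : pathspace G -> pathspace G :=
  plin (fun v es => if es is b :: es' then
    ((e == erev b)%:R * (mu (etgt e) / mu (etgt b)))%:C%C *: pvec (esrc e) es'
    else 0).

(* The sum over k in the product # makes this the left multiplication by the
   path [e] of length one. *)
Definition lmul_edge e x := creation e x + annihilation e x.

HB.instance Definition _ e := GRing.Linear.on (creation e).
HB.instance Definition _ e := GRing.Linear.on (annihilation e).

Lemma lmul_edge_is_linear e : linear (lmul_edge e).
Proof.
by move=> a x y; rewrite /lmul_edge !linearP scalerDr addrACA.
Qed.

HB.instance Definition _ e :=
  GRing.isLinear.Build C (pathspace G) (pathspace G) *:%R (lmul_edge e)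
    (lmul_edge_is_linear e).

(* Instances of [linearZZ] that, unlike it, have a rigid head symbol. *)
Lemma creationZ e a x : creation e (a *: x) = a *: creation e x.
Proof. exact: (linearZZ (creation e)). Qed.

Lemma annihilationZ e a x : annihilation e (a *: x) = a *: annihilation e x.
Proof. exact: (linearZZ (annihilation e)). Qed.

Lemma lmul_edgeZ e a x : lmul_edge e (a *: x) = a *: lmul_edge e x.
Proof. exact: (linearZZ (lmul_edge e)). Qed.

Lemma linextZ (V : lmodType C) (f : gpath G -> V) a x :
  linext f (a *: x) = a *: linext f x.
Proof. exact: (linearZZ (linext f)). Qed.

Lemma creationP e a x y : creation e (a *: x + y) = a *: creation e x + creation e y.
Proof. exact: (linext_is_linear). Qed.

Lemma creation_sum e I (r : seq I) P (F : I -> pathspace G) :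
  creation e (\sum_(i <- r | P i) F i) = \sum_(i <- r | P i) creation e (F i).
Proof. exact: (linear_sum (creation e)). Qed.

Lemma lmul_edge_sum e I (r : seq I) P (F : I -> pathspace G) :
  lmul_edge e (\sum_(i <- r | P i) F i) = \sum_(i <- r | P i) lmul_edge e (F i).
Proof. exact: (linear_sum (lmul_edge e)). Qed.

Lemma linext_sum (V : lmodType C) (f : gpath G -> V) I (r : seq I) P
    (F : I -> pathspace G) :
  linext f (\sum_(i <- r | P i) F i) = \sum_(i <- r | P i) linext f (F i).
Proof. exact: (linear_sum (linext f)). Qed.

Lemma creation_pvec e es : creation e (pvec (etgt e) es) = pvec (esrc e) (e :: es).
Proof.
have [w|w] := boolP (walk (etgt e) es); first by rewrite /creation plin_pvec // eqxx.
by rewrite !pvec_nwalk ?linear0 //= negb_and w orbT.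
Qed.

Lemma creation_pvec_neq e v es : v != etgt e -> creation e (pvec v es) = 0.
Proof.
move=> ve; have [w|w] := boolP (walk v es).
  by rewrite /creation plin_pvec // (negbTE ve).
by rewrite pvec_nwalk ?linear0.
Qed.

Lemma annihilation_pvec0 e v : annihilation e (pvec v [::]) = 0.
Proof. by rewrite /annihilation plin_pvec. Qed.

Lemma annihilation_pvec e b es : annihilation e (pvec (etgt e) (b :: es)) =
  ((e == erev b)%:R * (mu (etgt e) / mu (etgt b)))%:C%C *: pvec (esrc e) es.
Proof.
have [w|w] := boolP (walk (etgt e) (b :: es)); first by rewrite /annihilation plin_pvec.
(* If the edges do not form a path, the left side is 0; if moreover [e] is the reverse of [b], then
   [es] is no path from [esrc e], and the right side is 0 too. *)
rewrite pvec_nwalk // linear0; case: eqVneq w => [->|] /=; last first.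
  by rewrite mul0r scale0r.
rewrite etgt_erev esrc_erev eqxx /= => w.
by rewrite (pvec_nwalk w) scaler0.
Qed.

Lemma lmul_edge_pvec_neq e v es : v != etgt e -> lmul_edge e (pvec v es) = 0.
Proof.
move=> ve; rewrite /lmul_edge creation_pvec_neq // add0r.
have [w|w] := boolP (walk v es); last by rewrite pvec_nwalk ?linear0.
rewrite /annihilation plin_pvec //; case: es w => //= b es /andP[/eqP bv _].
case: eqVneq => [eb|]; last by rewrite mul0r scale0r.
by move: ve; rewrite eb etgt_erev bv eqxx.
Qed.

End LinearExtension.

(** * The action of a diagram on a path *)

Section Weights.
Variables (R : realType) (G : graph R).
Local Notation C := R[i]%C.
Implicit Types (v : vert G) (es : seq (edge G)).

Definition cap_weight (a b : edge G) : R :=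
  (a == erev b)%:R * (mu (etgt a) / mu (etgt b)).

(** Indices are natural numbers, so that prefixing an edge is a plain shift; the value 0 stands for
    indices out of range. *)
Definition onth_weight es i j : R :=
  if onth es i is Some a then
    if onth es j is Some b then cap_weight a b else 0
  else 0.

Definition weight n es (p : {ffun 'I_n -> 'I_n}) : R :=
  \prod_(i < n | (i < p i)%N) onth_weight es i (p i).

Definition through_edges n es (p : {ffun 'I_n -> 'I_n}) : seq (edge G) :=
  pmap (fun t : 'I_n => onth es t) (fixed_points p).

(** The initial vertex is a parameter, which gives the image a start even when no edge is left. *)
Definition act v n es (p : {ffun 'I_n -> 'I_n}) : pathspace G :=
  (weight es p)%:C%C *: pvec v (through_edges es p).

Lemma weight_add_through n e es (p : {ffun 'I_n -> 'I_n}) :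
  weight (e :: es) (add_through p) = weight es p.
Proof.
rewrite /weight big_mkcond big_ord_recl add_through0 ltnn /= mul1r [RHS]big_mkcond /=.
apply: eq_bigr => i _.
by rewrite add_through_lift !lift0 ltnS.
Qed.

Lemma weight_add_cap n e es (p : {ffun 'I_n -> 'I_n}) k : p k = k ->
  weight (e :: es) (add_cap p k) = onth_weight (e :: es) 0 k.+1 * weight es p.
Proof.
move=> pk; rewrite /weight big_mkcond big_ord_recl add_cap0 lift0 /=; congr (_ * _).
rewrite [RHS]big_mkcond /=; apply: eq_bigr => i _.
rewrite add_cap_lift; have [->|_] := eqVneq i k; first by rewrite pk ltn0 ltnn.
by rewrite !lift0 ltnS.
Qed.

Lemma pmap_map (T1 T2 T3 : Type) (f : T2 -> option T3) (g : T1 -> T2) s :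
  pmap f (map g s) = pmap (f \o g) s.
Proof. by elim: s => //= x s ->. Qed.

Lemma through_edges_add_through n e es (p : {ffun 'I_n -> 'I_n}) :
  through_edges (e :: es) (add_through p) = e :: through_edges es p.
Proof. by rewrite /through_edges fixed_points_add_through /= pmap_map. Qed.

Lemma through_edges_add_cap n e es (p : {ffun 'I_n -> 'I_n}) k r :
  fixed_points p = k :: r ->
  through_edges (e :: es) (add_cap p k) = pmap (fun t : 'I_n => onth es t) r.
Proof. by move=> E; rewrite /through_edges (fixed_points_add_cap E) pmap_map. Qed.

Lemma onth_ord es (k : 'I_(size es)) : exists b, onth es k = Some b.
Proof.
by have := ltn_ord k; rewrite -onthTE; case: onth => // b _; exists b.
Qed.

(** Mirrors [sum_ncinvS], with the capped point given as the head of the list of through-points. *)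
Lemma ncinvS_case n (P : {ffun 'I_n.+1 -> 'I_n.+1} -> Prop) :
  (forall p, ncinv p -> P (add_through p)) ->
  (forall p k r, ncinv p -> fixed_points p = k :: r -> P (add_cap p k)) ->
  forall q, ncinv q -> P q.
Proof.
move=> Pt Pc q ncq; case: (unliftP ord0 (q ord0)) => [k|] q0.
  have := ncq; rewrite -(add_cap_down q0 ncq).
  have /eqP : down q k = k by apply/eqP; rewrite -down_add_cap add_cap_down.
  move=> /eqP pk; rewrite ncinv_add_cap // => /andP[ncp fk].
  case E: (fixed_points (down q)) fk => [|l r].
    by rewrite first_fixed_nil.
  by rewrite (first_fixed_cons E) => /eqP ->; exact: Pc E.
by have := ncq; rewrite -(add_through_down q0 ncq) ncinv_add_through => /Pt.
Qed.

(* A cap joins mutually reverse edges, so deleting it leaves a path. *)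
Lemma through_edges_walk v es (p : {ffun 'I_(size es) -> 'I_(size es)}) :
  walk v es -> ncinv p -> weight es p != 0 ->
  walk v (through_edges es p) /\
  last v (map (@etgt R G) (through_edges es p)) = last v (map (@etgt R G) es).
Proof.
elim: es v p => [|e es IH] v /=.
  move=> p _ _ _; rewrite /through_edges.
  by case: (fixed_points p) => // -[].
move=> q /andP[/eqP ev wes]; move: q; apply: ncinvS_case => [p ncp|p k r ncp E].
  by rewrite weight_add_through through_edges_add_through /= ev eqxx => /(IH _ _ wes ncp).
have pk : p k = k by apply/eqP; rewrite -mem_fixed_points E mem_head.
rewrite weight_add_cap // mulf_eq0 negb_or => /andP[wk /(IH _ _ wes ncp)].
rewrite (through_edges_add_cap _ _ E) /through_edges E /=.
move: wk; rewrite /onth_weight /=; have [b ->] := onth_ord k.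
rewrite /cap_weight /=; case: (eqVneq e (erev b)) => [eb _ /= [/andP[_ wr] <-]|_].
  by rewrite -ev eb esrc_erev.
by rewrite mul0r eqxx.
Qed.

Lemma act_add_through e es (p : {ffun 'I_(size es) -> 'I_(size es)}) :
  act (esrc e) (e :: es) (add_through p) = creation e (act (etgt e) es p).
Proof. by rewrite /act weight_add_through through_edges_add_through creationZ creation_pvec. Qed.

(** The cap cancels [e] against the first edge of the image under [p], and its weight is the
    coefficient of [annihilation e]. *)
Lemma act_add_cap e es (p : {ffun 'I_(size es) -> 'I_(size es)}) k r :
  fixed_points p = k :: r ->
  act (esrc e) (e :: es) (add_cap p k) = annihilation e (act (etgt e) es p).
Proof.
move=> E; have pk : p k = k by apply/eqP; rewrite -mem_fixed_points E mem_head.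
rewrite /act weight_add_cap // (through_edges_add_cap _ _ E) annihilationZ.
rewrite /through_edges E /onth_weight /=; have [b ->] := onth_ord k.
by rewrite annihilation_pvec scalerA -rmorphM mulrC.
Qed.

(** Each cap is counted once, by its left end [i]; the other end can only be [p i]. *)
Lemma prod_caps n (p : {ffun 'I_n -> 'I_n}) (f : 'I_n -> 'I_n -> R) : ncinv p ->
  \prod_(ij : 'I_n * 'I_n | (ij.1 < ij.2)%N &&
    ([set ij.1; ij.2] \in caps (diagram_of p))) f ij.1 ij.2 =
  \prod_(i < n | (i < p i)%N) f i (p i).
Proof.
move=> ncp.
rewrite -(pair_big_dep xpredT (fun i j : 'I_n => (i < j)%N &&
  ([set i; j] \in caps (diagram_of p))) f) /=.
rewrite [RHS]big_mkcond; apply: eq_bigr => i _.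
under eq_bigl => j do rewrite caps_pair_partner //.
case: ifP => ip.
  rewrite (big_pred1 (p i)) // => j /=.
  have [->|] := eqVneq j (p i); last by rewrite !andbF.
  by rewrite ip andbT -val_eqE /=; apply/eqP; lia.
rewrite big_pred0 // => j; have [->|] := eqVneq j (p i); last by rewrite !andbF.
by rewrite ip.
Qed.

Lemma vtx_esrc (xi : gpath G) i a :
  onth (edges xi) i = Some a -> vtx xi i = esrc a.
Proof.
case: xi => -[v es] w; rewrite /vtx /edges /psrc /=.
have : walk v es by [].
(* The default of [nth] is made independent of [v], since the induction changes the initial
   vertex. *)
move=> {w}; move: {2}v => v0; elim: es v i => [|e es IH] v [|i] //=.
  by move=> /andP[/eqP <- _] [->].
by move=> /andP[_ w] /(IH _ _ w) <-; case: i.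
Qed.

Lemma vtx_etgt (xi : gpath G) i a :
  onth (edges xi) i = Some a -> vtx xi i.+1 = etgt a.
Proof.
move=> E; have lt : (i < size (edges xi))%N by rewrite -onthTE E.
by rewrite /vtx /= (nth_map a) // (@onth_nth _ a _ _ _ E).
Qed.

Lemma weight_edges (xi : gpath G) (p : {ffun 'I_(plen xi) -> 'I_(plen xi)}) :
  weight (edges xi) p = \prod_(i < plen xi | (i < p i)%N)
    (edelta xi i xi (p i) * (mu (vtx xi i.+1) / mu (vtx xi (p i).+1))).
Proof.
apply: eq_bigr => i _.
have [a ea] := @onth_ord (edges xi) i; have [b eb] := @onth_ord (edges xi) (p i).
by rewrite (vtx_etgt ea) (vtx_etgt eb) /edelta /onth_weight ea eb.
Qed.

(** [diagram_act] starts the image at the source of the first through-edge, or at the final vertex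
    of [xi] if there is none, whereas [act] starts it at [psrc xi]. By [through_edges_walk] these
    agree unless the weight is 0. *)
Lemma diagram_actE (xi : gpath G) (p : {ffun 'I_(plen xi) -> 'I_(plen xi)}) :
  ncinv p -> diagram_act (diagram_of p) = act (psrc xi) (edges xi) p.
Proof.
move=> ncp; rewrite /diagram_act enum_through -/(through_edges (edges xi) p).
set w := \prod_(ij | _) _.
have -> : w = weight (edges xi) p.
  pose f (i j : 'I_(plen xi)) :=
    edelta xi i xi j * (mu (vtx xi i.+1) / mu (vtx xi j.+1)).
  by rewrite weight_edges; apply: etrans (prod_caps f ncp) _.
rewrite /act; have [->|w0] := eqVneq (weight (edges xi) p) 0; first by rewrite !scale0r.
have [wt lt] := through_edges_walk (valP xi) ncp w0.
congr (_ *: pvec _ _); rewrite ptgtE.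
move: wt lt; rewrite /psrc; case: through_edges => [_ <- //|b r /= /andP[/eqP]].
by [].
Qed.

End Weights.

(** * The recursions for phi and psi, and their mutual inversion *)

Lemma sum_epiTL n (V : nmodType) (P : pred (diagram n)) (F : diagram n -> V) :
  \sum_(m < n.+1) \sum_(S | (S \in epiTL n m) && P S) F S =
  \sum_(p | ncinv p && P (diagram_of p)) F (diagram_of p).
Proof.
rewrite -sum_epi.
(* There are at most [n] through-points, so [inord] preserves their number and the sum over [m] is a
   partition by that number. *)
rewrite [RHS](partition_big (fun S : diagram n => inord #|through S| : 'I_n.+1) xpredT) //.
apply: eq_bigr => m _; apply: eq_bigl => S.
rewrite mem_epiTL -val_eqE /= inordK; last first.
  by rewrite ltnS -[X in (_ <= X)%N](card_ord n) max_card.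
by rewrite [RHS]andbC andbA.
Qed.

Lemma sum_first_fixed n (V : nmodType) (p : {ffun 'I_n -> 'I_n}) (F : 'I_n -> V) :
  \sum_(k | first_fixed p k) F k = if fixed_points p is k :: _ then F k else 0.
Proof.
case E: (fixed_points p) => [|k r].
  by rewrite big_pred0 // => k; rewrite first_fixed_nil.
by rewrite (big_pred1 k) // => l; rewrite (first_fixed_cons E).
Qed.

Section PhiPsi.
Variables (R : realType) (G : graph R).
Local Notation C := R[i]%C.
Implicit Types (v : vert G) (es : seq (edge G)) (x y : pathspace G).

Local Notation phi := (@phi R G : pathspace G -> pathspace G).
Local Notation psi := (@psi R G : pathspace G -> pathspace G).

Lemma phi_pvec v es : walk v es ->
  phi (pvec v es) = \sum_(p : {ffun 'I_(size es) -> 'I_(size es)} | ncinv p)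
                      act v es p.
Proof.
move=> w; rewrite pvecE /phi linext_basis /phi_path.
set xi := Sub (v, es) w : gpath G; rewrite -[es]/(edges xi).
transitivity (\sum_(m < (plen xi).+1)
  \sum_(S | (S \in epiTL (plen xi) m) && xpredT S) diagram_act S).
  by apply: eq_bigr => m _; apply: eq_bigl => S; rewrite andbT.
rewrite sum_epiTL; apply: eq_big => [p|p /andP[ncp _]]; first by rewrite andbT.
exact: diagram_actE.
Qed.

Lemma card_through n (p : {ffun 'I_n -> 'I_n}) :
  #|through (diagram_of p)| = size (fixed_points p).
Proof. by rewrite cardE enum_through. Qed.

(** For a non-crossing involution the exponent is the number of caps. *)
Definition psi_sign n (p : {ffun 'I_n -> 'I_n}) : C :=
  (-1) ^+ ((n - size (fixed_points p))./2).

Lemma psi_pvec v es : walk v es ->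
  psi (pvec v es) =
  \sum_(p : {ffun 'I_(size es) -> 'I_(size es)} |
          ncinv p && non_nested (diagram_of p)) psi_sign p *: act v es p.
Proof.
move=> w; rewrite pvecE /psi linext_basis /psi_path.
set xi := Sub (v, es) w : gpath G; rewrite -[es]/(edges xi).
pose F (S : diagram (plen xi)) : pathspace G :=
  (-1) ^+ ((plen xi - #|through S|)./2) *: diagram_act S.
transitivity (\sum_(m < (plen xi).+1)
  \sum_(S | (S \in epiTL (plen xi) m) && non_nested S) F S).
  apply: eq_bigr => m _; rewrite scaler_sumr; apply: eq_bigr => S /andP[+ _].
  by rewrite mem_epiTL => /andP[/eqP <- _].
rewrite sum_epiTL; apply: eq_bigr => p /andP[ncp _].
by rewrite /F card_through diagram_actE.
Qed.

Lemma phi_vertex v : phi (pvec v [::]) = pvec v [::].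
Proof.
rewrite phi_pvec // (big_pred1 [ffun i => i]) => [|p].
  rewrite /act /weight big_ord0 scale1r; congr pvec.
  by rewrite /through_edges; case: (fixed_points _) => // -[].
have -> : p = [ffun i => i] by apply/ffunP => -[].
rewrite /= eqxx; apply/ncinvP; split; by case.
Qed.

Lemma psi_vertex v : psi (pvec v [::]) = pvec v [::].
Proof.
rewrite psi_pvec // (big_pred1 [ffun i => i]) => [|p].
  have -> : psi_sign [ffun i : 'I_(size (Nil (edge G))) => i] = 1 by [].
  rewrite /act /weight big_ord0 !scale1r; congr pvec.
  by rewrite /through_edges; case: (fixed_points _) => // -[].
have -> : p = [ffun i => i] by apply/ffunP => -[].
rewrite /= eqxx; apply/andP; split; first by apply/ncinvP; split; case.
by apply/non_nestedP; [apply/ncinvP; split; case | case].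
Qed.

Lemma phi_cons e es : walk (etgt e) es ->
  phi (pvec (esrc e) (e :: es)) = lmul_edge e (phi (pvec (etgt e) es)).
Proof.
move=> w; rewrite !phi_pvec //=; last by rewrite eqxx.
under eq_bigl => q do rewrite -[ncinv q]andbT.
rewrite (sum_ncinvS xpredT) lmul_edge_sum.
under [X in _ + X]eq_bigr => k _ do rewrite big_mkcond.
(* With [p] outermost, each [p] contributes [add_through p] and at most one [add_cap p k], matching
   the two parts of [lmul_edge]. *)
rewrite exchange_big /=.
under [X in X + _]eq_bigl => p do rewrite andbT.
rewrite [X in X + _]big_mkcond [RHS]big_mkcond -big_split; apply: eq_bigr => p _ /=.
case: ifP => ncp; last by rewrite big1 ?addr0.
rewrite /lmul_edge act_add_through; congr (_ + _).
under eq_bigr => k _ do rewrite andbT.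
rewrite -big_mkcond sum_first_fixed; case E: (fixed_points p) => [|k r].
  (* Without through-points there is no cap to add, and the image is a vertex, which annihilation
     kills. *)
  by rewrite /act annihilationZ /through_edges E annihilation_pvec0 scaler0.
by rewrite (act_add_cap _ E).
Qed.

Lemma psi_sign_add_through n (p : {ffun 'I_n -> 'I_n}) :
  psi_sign (add_through p) = psi_sign p.
Proof. by rewrite /psi_sign fixed_points_add_through /= size_map subSS. Qed.

Lemma size_fixed_points n (p : {ffun 'I_n -> 'I_n}) : (size (fixed_points p) <= n)%N.
Proof. by rewrite -card_through -[X in (_ <= X)%N](card_ord n) max_card. Qed.

(** Two bottom points and no through-point are added, hence one cap. *)
Lemma psi_sign_adjacent n (p : {ffun 'I_n -> 'I_n}) :
  psi_sign (add_cap (add_through p) ord0) = - psi_sign p.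
Proof.
have E := fixed_points_add_through p; rewrite /psi_sign (fixed_points_add_cap E) !size_map.
by rewrite -addn2 -addnBAC ?size_fixed_points // addn2 /= exprS mulN1r.
Qed.

(** In a non-nested diagram the first point is a through-point or is joined to its neighbour. The
    second kind comes from a non-nested diagram on the edges after the first two, with one cap more,
    hence the minus sign. *)
Lemma psi_cons e es : walk (etgt e) es ->
  psi (pvec (esrc e) (e :: es)) =
  creation e (psi (pvec (etgt e) es)) - psi (annihilation e (pvec (etgt e) es)).
Proof.
move=> w; rewrite psi_pvec //=; last by rewrite eqxx.
rewrite (sum_ncinvS (fun q => non_nested (diagram_of q))); congr (_ + _).
  rewrite psi_pvec // creation_sum; apply: eq_big => [p|p _].
    by case: (boolP (ncinv p)) => //= ncp; rewrite non_nested_add_through.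
  by rewrite psi_sign_add_through act_add_through -creationZ.
case: es w => [|b es] w.
  by rewrite big_ord0 annihilation_pvec0 /psi linear0 oppr0.
(* Non-nestedness leaves only the cap joining [e] to its neighbour [b]. *)
rewrite annihilation_pvec big_ord_recl [X in _ + X]big1 ?addr0; last first.
  move=> k _; rewrite big_pred0 // => p; apply/negP => /andP[/andP[ncp fk]].
  by rewrite non_nested_add_cap // andbF.
transitivity (\sum_(p : {ffun 'I_(size es).+1 -> 'I_(size es).+1} |
    ncinv p && (first_fixed p ord0 && non_nested (diagram_of p)))
  psi_sign (add_cap p ord0) *: act (esrc e) (e :: b :: es) (add_cap p ord0)).
  apply: eq_bigl => p; rewrite -andbA; case: (boolP (ncinv p)) => //= ncp.
  case: (boolP (first_fixed p ord0)) => //= f0.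
  by rewrite non_nested_add_cap // andbT.
(* The point of [b] must be free before the cap is drawn, which excludes the [add_cap] part of the
   sum. *)
rewrite (sum_ncinvS (fun p => first_fixed p ord0 && non_nested (diagram_of p))).
rewrite [X in _ + X]big1 ?addr0; last first.
  move=> k _; rewrite big_pred0 // => p.
  by rewrite /first_fixed add_cap0 lift0_eq0 !andbF.
have f0 n (p : {ffun 'I_n -> 'I_n}) : first_fixed (add_through p) ord0.
  by rewrite (first_fixed_cons (fixed_points_add_through p)).
have act0 (p : {ffun 'I_(size es) -> 'I_(size es)}) :
    act (esrc e) (e :: b :: es) (add_cap (add_through p) ord0) =
    (cap_weight e b)%:C%C *: act (esrc e) es p.
  rewrite (@act_add_cap R G e (b :: es) _ _ _ (fixed_points_add_through p)) /act weight_add_through through_edges_add_through.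
  by rewrite annihilationZ annihilation_pvec !scalerA mulrC.
rewrite /psi linextZ -/(psi _).
(* If [e] is not the reverse of [b], everything vanishes; if it is, [es] is a path from [esrc e] and
   [psi_pvec] applies. *)
have [eb|neb] := eqVneq e (erev b); last first.
  rewrite mul0r scale0r oppr0 big1 // => p _.
  by rewrite act0 /cap_weight (negbTE neb) mul0r scale0r scaler0.
rewrite psi_pvec; last by rewrite eb esrc_erev; case/andP: w.
rewrite scaler_sumr -sumrN; apply: eq_big => [p|p _].
  by case: (boolP (ncinv p)) => //= ncp; rewrite f0 non_nested_add_through.
rewrite psi_sign_adjacent act0 [LHS]scaleNr; apply: congr1.
by rewrite [LHS]scalerA [RHS]scalerA mulrC /cap_weight eb eqxx.
Qed.

Lemma phi_is_linear : linear phi.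
Proof. exact: linext_is_linear. Qed.

Lemma psi_is_linear : linear psi.
Proof. exact: linext_is_linear. Qed.

Lemma phi0 : phi 0 = 0.
Proof. exact: (linear0 (linext _)). Qed.

Lemma psi0 : psi 0 = 0.
Proof. exact: (linear0 (linext _)). Qed.

Lemma phiB x y : phi (x - y) = phi x - phi y.
Proof. exact: (linearB (linext _)). Qed.

Lemma phi_creation e x : phi (creation e x) = lmul_edge e (phi x).
Proof.
move: x; apply: linear_eq => [a x y|a x y|v es w].
- by rewrite creationP phi_is_linear.
- by rewrite phi_is_linear lmul_edge_is_linear.
have [ve|ve] := eqVneq v (etgt e).
  by move: w; rewrite ve => w; rewrite creation_pvec phi_cons.
rewrite (creation_pvec_neq _ ve) phi0 (phi_pvec w) lmul_edge_sum big1 // => p _.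
by rewrite /act lmul_edgeZ lmul_edge_pvec_neq ?scaler0.
Qed.

Lemma psi_lmul_edge e x : psi (lmul_edge e x) = creation e (psi x).
Proof.
move: x; apply: linear_eq => [a x y|a x y|v es w].
- by rewrite lmul_edge_is_linear psi_is_linear.
- by rewrite psi_is_linear creationP.
have [ve|ve] := eqVneq v (etgt e).
  move: w; rewrite ve => w; rewrite /lmul_edge creation_pvec.
  by rewrite -[X in psi (X + _)]scale1r psi_is_linear scale1r psi_cons // subrK.
rewrite (lmul_edge_pvec_neq _ ve) psi0 (psi_pvec w) creation_sum big1 => [//|p _].
by rewrite creationZ /act creationZ creation_pvec_neq ?scaler0.
Qed.

Lemma phiK_pvec v es : psi (phi (pvec v es)) = pvec v es.
Proof.
have [w|w] := boolP (walk v es); last by rewrite pvec_nwalk // !(phi0, psi0).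
elim: es v w => [|e es IH] v /=; first by rewrite phi_vertex psi_vertex.
move=> /andP[/eqP <- w].
by rewrite phi_cons // psi_lmul_edge IH // creation_pvec.
Qed.

(** The induction is strong because [psi_cons] also involves the annihilated path, which is two
    edges shorter; its term cancels the annihilation part of [lmul_edge]. *)
Lemma psiK_pvec v es : phi (psi (pvec v es)) = pvec v es.
Proof.
have [n] := ubnP (size es); elim: n v es => // n IH v es szn.
have [w|w] := boolP (walk v es); last by rewrite pvec_nwalk // !(phi0, psi0).
case: es szn w => [|e es] szn; first by rewrite psi_vertex phi_vertex.
move=> /= /andP[/eqP <- w].
have IHa : phi (psi (annihilation e (pvec (etgt e) es))) =
    annihilation e (pvec (etgt e) es).
  case: es szn {w} => [|b es] szn.
    by rewrite annihilation_pvec0 psi0 phi0.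
  rewrite annihilation_pvec /psi linextZ -/(psi _) /phi linextZ -/(phi _) IH //.
  exact: ltnW szn.
rewrite (psi_cons w) phiB.
apply: etrans (congr2 (fun a b => a - b) (phi_creation _ _) IHa) _.
rewrite (IH _ _ szn).
by rewrite /lmul_edge creation_pvec addrK.
Qed.

Lemma phiK : cancel phi psi.
Proof.
apply: linear_eq => [a x y|//|v es _]; last exact: phiK_pvec.
by rewrite phi_is_linear psi_is_linear.
Qed.

Lemma psiK : cancel psi phi.
Proof.
apply: linear_eq => [a x y|//|v es _]; last exact: psiK_pvec.
by rewrite psi_is_linear phi_is_linear.
Qed.

End PhiPsi.

(** * The two products *)

Section Products.
Variables (R : realType) (G : graph R).
Local Notation C := R[i]%C.
Implicit Types (v w : vert G) (e : edge G) (es fs : seq (edge G)).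
Implicit Types x y : pathspace G.

Local Notation sharp := (bilext (@sharp_path R G)).
Local Notation concat := (bilext (@concat_path R G)).
Local Notation finish v es := (last v (map (@etgt R G) es)).

(** Serves for identities involving [star], which is only conjugate-linear and so escapes
    [linear_eq]. *)
Lemma pathspace_ind (P : pathspace G -> Prop) :
  P 0 -> (forall a x y, P x -> P y -> P (a *: x + y)) ->
  (forall v es, walk v es -> P (pvec v es)) -> forall x, P x.
Proof.
move=> P0 PD Pb x; rewrite (pathspaceE x); elim/big_rec: _ => // xi y _ Py.
by apply: PD => //; rewrite basis_pvec; apply: Pb; exact: valP xi.
Qed.

Lemma bilextPl f a x x' y :
  bilext f (a *: x + x') y = a *: bilext f x y + bilext f x' y :> pathspace G.
Proof. exact: linext_is_linear. Qed.

Lemma bilextPr f x a y y' :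
  bilext f x (a *: y + y') = a *: bilext f x y + bilext f x y' :> pathspace G.
Proof.
have linext_fun (g h k : gpath G -> pathspace G) :
    (forall xi, k xi = a *: g xi + h xi) ->
    linext k x = a *: linext g x + linext h x.
  move=> E; rewrite /linext scaler_sumr -big_split; apply: eq_bigr => xi _ /=.
  by rewrite E scalerDr !scalerA mulrC.
by apply: linext_fun => xi; exact: linext_is_linear.
Qed.

HB.instance Definition _ f x :=
  GRing.isLinear.Build C (pathspace G) (pathspace G) *:%R (bilext f x)
    (fun a y y' => bilextPr f x a y y').

Lemma bilext0l f y : bilext f 0 y = 0 :> pathspace G.
Proof. exact: (linear0 (linext _)). Qed.

Lemma bilext0r f x : bilext f x 0 = 0 :> pathspace G.
Proof. exact: (linear0 (bilext f x)). Qed.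

Lemma bilextZl f a x y : bilext f (a *: x) y = a *: bilext f x y :> pathspace G.
Proof. exact: (linearZZ (linext _)). Qed.

Lemma bilextZr f a x y : bilext f x (a *: y) = a *: bilext f x y :> pathspace G.
Proof. exact: (linearZZ (bilext f x)). Qed.

Lemma bilextDl f x x' y :
  bilext f (x + x') y = bilext f x y + bilext f x' y :> pathspace G.
Proof. exact: (linearD (linext _)). Qed.

Lemma bilext_sumr f x I (r : seq I) P (F : I -> pathspace G) :
  bilext f x (\sum_(i <- r | P i) F i) =
  \sum_(i <- r | P i) bilext f x (F i) :> pathspace G.
Proof. exact: (linear_sum (bilext f x)). Qed.

Lemma concat_pvec v es w fs : walk v es -> walk w fs ->
  concat (pvec v es) (pvec w fs) =
  if finish v es == w then pvec v (es ++ fs) else 0.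
Proof.
move=> wv ww; rewrite (pvecE wv) (pvecE ww) /bilext !linext_basis /concat_path.
by rewrite ptgtE.
Qed.

Definition delta_edges es i fs j : R :=
  (onth es i == omap (@erev R G) (onth fs j))%:R.

Definition sharp_coef v es fs k : R :=
  (\prod_(i < k) delta_edges es (size es - i.+1) fs i) *
  (mu (finish v es) / mu (nth v (v :: map (@etgt R G) es) (size es - k))).

Definition sharp_term v es fs k : pathspace G :=
  (sharp_coef v es fs k)%:C%C *: pvec v (take (size es - k) es ++ drop k fs).

Lemma sharp_pvec_minn v es w fs : walk v es -> walk w fs ->
  sharp (pvec v es) (pvec w fs) =
  if finish v es == w then
    \sum_(k < (minn (size es) (size fs)).+1) sharp_term v es fs k else 0.
Proof.
move=> wv ww; rewrite (pvecE wv) (pvecE ww) /bilext !linext_basis /sharp_path.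
by rewrite !ptgtE.
Qed.

(** Makes the range of summation depend on the left factor alone, so that it grows by one when an
    edge is prefixed. *)
Lemma sharp_coef_gt v es fs k : (size fs < k <= size es)%N ->
  sharp_coef v es fs k = 0.
Proof.
move=> /andP[fk kn]; rewrite /sharp_coef (bigD1 (Ordinal fk)) //=.
rewrite /delta_edges (onth_default (leqnn (size fs))) /=.
(* As [size fs < size es], this edge exists and differs from the missing one of [fs]; two missing
   edges would compare equal. *)
have : onth es (size es - (size fs).+1) by rewrite onthTE; lia.
by case: onth => // b _; rewrite !mul0r.
Qed.

Lemma sharp_pvec v es w fs : walk v es -> walk w fs ->
  sharp (pvec v es) (pvec w fs) =
  if finish v es == w then \sum_(k < (size es).+1) sharp_term v es fs k else 0.
Proof.
move=> wv ww; rewrite (sharp_pvec_minn wv ww); case: ifP => // _.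
have le : ((minn (size es) (size fs)).+1 <= (size es).+1)%N by rewrite ltnS geq_minl.
rewrite (big_ord_widen _ (sharp_term v es fs) le) big_mkcond; apply: eq_bigr => k _ /=.
case: ifP => // km; have := ltn_ord k => kn.
by rewrite /sharp_term sharp_coef_gt ?scale0r //; lia.
Qed.

Lemma sharp_vertex v w fs :
  sharp (pvec v [::]) (pvec w fs) = if v == w then pvec w fs else 0.
Proof.
have [ww|ww] := boolP (walk w fs); last first.
  by rewrite (pvec_nwalk ww) bilext0r if_same.
rewrite sharp_pvec //=; case: eqVneq => // ->.
rewrite big_ord1 /sharp_term /sharp_coef big_ord0 /= drop0 divff ?mulr1 ?scale1r //.
by rewrite lt0r_neq0 // mu_gt0.
Qed.

(** With [k <= size es] the cancellation does not reach the new edge [e]. *)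
Lemma sharp_coef_cons e es fs k : (k <= size es)%N ->
  sharp_coef (esrc e) (e :: es) fs k = sharp_coef (etgt e) es fs k.
Proof.
move=> kn; rewrite /sharp_coef /= subSn //=; congr (_ * _); last first.
  congr (_ * (mu _)^-1).
  by apply: set_nth_default; rewrite /= size_map; lia.
apply: eq_bigr => i _; rewrite subSS /delta_edges -(@subnSK i) //.
exact: leq_trans kn.
Qed.

Lemma creation_sharp_term e es fs k : (k <= size es)%N ->
  creation e (sharp_term (etgt e) es fs k) = sharp_term (esrc e) (e :: es) fs k.
Proof.
move=> kn; rewrite /sharp_term creationZ creation_pvec (sharp_coef_cons _ _ kn).
by rewrite [size (e :: es)]/= (subSn kn).
Qed.

(** Once all of [es] has cancelled, [e] meets the next edge of [fs]; annihilating it is one further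
    cancellation. *)
Lemma annihilation_sharp_term_last e es fs :
  annihilation e (sharp_term (etgt e) es fs (size es)) =
  sharp_term (esrc e) (e :: es) fs (size es).+1.
Proof.
rewrite /sharp_term annihilationZ !subnn !take0 !cat0s /sharp_coef !subnn /=.
rewrite big_ord_recr /= subnn.
have -> : \prod_(i < size es) delta_edges (e :: es) ((size es).+1 - i.+1) fs i =
          \prod_(i < size es) delta_edges es (size es - i.+1) fs i.
  by apply: eq_bigr => i _; rewrite /delta_edges subSS -[in LHS](subnSK (ltn_ord i)).
(* If [fs] has no further edge, both sides vanish. *)
rewrite /delta_edges /=; case: (ltnP (size es) (size fs)) => sz; last first.
  rewrite (drop_oversize sz) annihilation_pvec0 scaler0 (onth_default sz).
  by rewrite /= mulr0 mul0r [RHS]scale0r.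
have [b /= E] := onth_ord (Ordinal sz).
rewrite E.
rewrite (drop_nth b sz) (@onth_nth _ b _ _ _ E) annihilation_pvec scalerA -rmorphM.
set z := pvec _ _; apply: (congr1 (fun c : R => c%:C%C *: z)); rewrite /=.
have [->|] := eqVneq e (erev b); last first.
  by rewrite -(inj_eq (@Some_inj _)) => /negbTE ->; rewrite mul0r !mulr0 mul0r.
(* The two quotients of weights telescope: [mu (etgt e)], the weight where [e] meets [b],
   cancels. *)
rewrite eqxx esrc_erev etgt_erev !mul1r mulr1 -!mulrA; congr (_ * (_ * _)).
by rewrite mulKf // lt0r_neq0 // mu_gt0.
Qed.

(** The first edge [b] survives these [k] cancellations, so [e] acts on [b] alone. *)
Lemma annihilation_sharp_term e b es fs k : (k <= size es)%N ->
  esrc b = etgt e ->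
  annihilation e (sharp_term (etgt e) (b :: es) fs k) =
  (cap_weight e b)%:C%C *: sharp_term (esrc e) es fs k.
Proof.
move=> kn eb; rewrite /sharp_term annihilationZ [size (b :: es)]/= (subSn kn).
rewrite [take _ _]/= cat_cons annihilation_pvec [LHS]scalerA [RHS]scalerA.
rewrite -eb (sharp_coef_cons _ _ kn) /cap_weight.
have [eb'|ne] := eqVneq e (erev b); first by rewrite eb' esrc_erev etgt_erev [in LHS]mulrC.
by rewrite !mul0r mulr0 [LHS]scale0r [RHS]scale0r.
Qed.

(** Associativity of # with an edge on the left, by matching cancellations: [e] survives, or cancels
    into [fs] after all of [es], or cancels the first edge of [es]. *)
Lemma sharp_lmul_edge e x y : sharp (lmul_edge e x) y = lmul_edge e (sharp x y).
Proof.
move: x; apply: linear_eq => [a x x'|a x x'|v es wv].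
- by rewrite lmul_edge_is_linear bilextPl.
- by rewrite bilextPl lmul_edge_is_linear.
move: y; apply: linear_eq => [a y y'|a y y'|w fs ww].
- by rewrite bilextPr.
- by rewrite bilextPr lmul_edge_is_linear.
rewrite (sharp_pvec wv ww).
have lmul0 : lmul_edge e 0 = 0 by exact: (linear0 (lmul_edge e)).
have [ve|ve] := eqVneq v (etgt e); last first.
  rewrite (lmul_edge_pvec_neq _ ve) bilext0l; case: ifP => _; last by rewrite lmul0.
  rewrite lmul_edge_sum big1 => [//|k _].
  by rewrite /sharp_term lmul_edgeZ (lmul_edge_pvec_neq _ ve) scaler0.
move: wv; rewrite {}ve => wv.
have -> : lmul_edge e (pvec (etgt e) es) =
    pvec (esrc e) (e :: es) + annihilation e (pvec (etgt e) es).
  by rewrite /lmul_edge creation_pvec.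
rewrite bilextDl.
have wev : walk (esrc e) (e :: es) by rewrite /= eqxx.
rewrite (sharp_pvec wev ww) [last _ _]/=.
case: es wv wev => [|b es] wv wev.
  rewrite annihilation_pvec0 bilext0l addr0; case: ifP => _; last by rewrite lmul0.
  have H1 := creation_sharp_term e fs (leqnn (size (Nil (edge G)))).
  have H2 := annihilation_sharp_term_last e [::] fs.
  rewrite [in RHS]big_ord1 big_ord_recr big_ord1 /=.
  exact: (congr2 (fun a b => a + b) (esym H1) (esym H2)).
rewrite annihilation_pvec bilextZl.
have eb : esrc b = etgt e by case/andP: wv => /eqP.
(* A nonzero coefficient makes [e] the reverse of [b], so only then is [es] known to be a path from
   [esrc e]. *)
have wb : cap_weight e b != 0 -> walk (esrc e) es /\ esrc e = etgt b.
  rewrite /cap_weight; case: (eqVneq e (erev b)) => [->|]; last by rewrite mul0r eqxx.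
  by rewrite esrc_erev; case/andP: wv.
have -> : (cap_weight e b)%:C%C *: sharp (pvec (esrc e) es) (pvec w fs) =
  if finish (etgt b) es == w then
    \sum_(k < (size es).+1) (cap_weight e b)%:C%C *: sharp_term (esrc e) es fs k
  else 0.
  have [->|/wb [we ee]] := eqVneq (cap_weight e b) 0.
    rewrite [LHS]scale0r; case: ifP => // _.
    by rewrite big1 => [//|k _]; rewrite [LHS]scale0r.
  rewrite (sharp_pvec we ww) ee; case: (_ == w); last exact: scaler0.
  exact: scaler_sumr.
rewrite [last _ _]/=; case: (_ == w); last by rewrite addr0 lmul0.
rewrite lmul_edge_sum; under [RHS]eq_bigr => k _ do rewrite /lmul_edge.
(* Creation gives all terms for [e :: b :: es] but the last, which is the annihilation of the fully
   cancelled summand. *)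
rewrite [RHS]big_split big_ord_recr -!addrA; congr (_ + _).
  apply: eq_bigr => k _; rewrite creation_sharp_term => [//|].
  by rewrite -ltnS ltn_ord.
rewrite addrC [RHS]big_ord_recr; congr (_ + _).
  apply: eq_bigr => k _; rewrite annihilation_sharp_term => [//||//].
  exact: (ltn_ord k).
by rewrite annihilation_sharp_term_last.
Qed.

Lemma concat_creation e x y : concat (creation e x) y = creation e (concat x y).
Proof.
move: x; apply: linear_eq => [a x x'|a x x'|v es wv].
- by rewrite creationP bilextPl.
- by rewrite bilextPl creationP.
move: y; apply: linear_eq => [a y y'|a y y'|w fs ww].
- by rewrite bilextPr.
- by rewrite bilextPr creationP.
have creation0 : creation e 0 = 0 by exact: (linear0 (linext _)).
rewrite (concat_pvec wv ww).
have [ve|ve] := eqVneq v (etgt e); last first.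
  rewrite (creation_pvec_neq _ ve) bilext0l.
  by case: (_ == w); rewrite ?creation0 ?(creation_pvec_neq _ ve).
move: wv; rewrite {}ve => wv.
have wev : walk (esrc e) (e :: es) by rewrite /= eqxx.
rewrite creation_pvec (concat_pvec wev ww) [last _ _]/=.
by case: (_ == w); rewrite ?creation0 ?creation_pvec.
Qed.

Lemma concat_vertex v w fs :
  concat (pvec v [::]) (pvec w fs) = if v == w then pvec w fs else 0.
Proof.
have [ww|ww] := boolP (walk w fs); last first.
  by rewrite (pvec_nwalk ww) bilext0r if_same.
by rewrite concat_pvec //=; case: eqVneq => // ->.
Qed.

Local Notation phi := (@phi R G : pathspace G -> pathspace G).

Lemma phiM x y : phi (concat x y) = sharp (phi x) (phi y).
Proof.
move: x; apply: linear_eq => [a x x'|a x x'|v es wv].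
- by rewrite bilextPl phi_is_linear.
- by rewrite phi_is_linear bilextPl.
elim: es v wv => [|e es IH] v /=.
  move=> _; rewrite phi_vertex.
  move: y; apply: linear_eq => [a y y'|a y y'|w fs ww].
  - by rewrite bilextPr phi_is_linear.
  - by rewrite phi_is_linear bilextPr.
  (* In both products a vertex on the left selects the paths starting there, and all terms of
     [phi (pvec w fs)] start at [w]. *)
  rewrite concat_vertex (phi_pvec ww) bilext_sumr.
  have [->|vw] := eqVneq v w.
    rewrite (phi_pvec ww); apply: eq_bigr => p _.
    by rewrite /act bilextZr sharp_vertex eqxx.
  rewrite phi0 big1 => [//|p _].
  by rewrite /act bilextZr sharp_vertex (negbTE vw) scaler0.
move=> /andP[/eqP <- w].
rewrite (phi_cons w) sharp_lmul_edge -(IH _ w) -phi_creation.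
by rewrite -concat_creation creation_pvec.
Qed.

(** * The involution *)

Lemma starP a x y : star (a *: x + y) = a^* *: star x + star y.
Proof.
have starE (z : pathspace G) (D : {fset gpath G}) : (msupp z `<=` D)%fset ->
    star z = \sum_(xi <- D) (z@_xi)^* *: (<< Defs.rev_path xi >> : pathspace G).
  move=> sD; rewrite /star; apply: big_fset_incl => // xi _ xiN.
  by rewrite (mcoeff_outdom xiN) conjC0 scale0r.
pose D := (msupp x `|` msupp y)%fset.
rewrite (starE _ D) ?(starE x D) ?(starE y D) ?fsubsetUl ?fsubsetUr //; last first.
  apply: fsubset_trans (msuppD_le _ _) _.
  by apply: fsetUSS; [exact: msuppZ_le | exact: fsubset_refl].
rewrite scaler_sumr -big_split; apply: eq_bigr => xi _ /=.
by rewrite mcoeffD mcoeffZ rmorphD rmorphM scalerDl scalerA.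
Qed.

Lemma star0 : star 0 = 0 :> pathspace G.
Proof. by rewrite /star msupp0 big_seq_fset0. Qed.

Lemma starZ a x : star (a *: x) = a^* *: star x.
Proof. by rewrite -[a *: x]addr0 starP star0 addr0. Qed.

Lemma starD x y : star (x + y) = star x + star y.
Proof. by rewrite -[x in LHS]scale1r starP conjC1 scale1r. Qed.

Lemma star_pvec v es : walk v es ->
  star (pvec v es) = pvec (finish v es) (rev (map (@erev R G) es)).
Proof.
move=> w; rewrite (pvecE w) /star msuppU oner_eq0 big_seq_fset1 mcoeffUU conjC1.
rewrite scale1r basis_pvec; congr pvec.
by rewrite /psrc /= ptgtE.
Qed.

Lemma finish_rev v es : walk v es ->
  finish (finish v es) (rev (map (@erev R G) es)) = v.
Proof.
case: es => //= e es /andP[/eqP <- _].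
by rewrite rev_cons map_rcons last_rcons etgt_erev.
Qed.

Lemma sharp_term0 v es fs : sharp_term v es fs 0 = pvec v (es ++ fs).
Proof.
rewrite /sharp_term /sharp_coef big_ord0 subn0 take_size drop0.
have -> : nth v (v :: map (@etgt R G) es) (size es) = finish v es.
  by rewrite (last_nth v) size_map.
rewrite divff ?mul1r ?[LHS]scale1r => [//|].
by rewrite lt0r_neq0 // mu_gt0.
Qed.

Lemma sharp_term_rcons1 v es c f : sharp_term v (rcons es c) [:: f] 1 =
  ((c == erev f)%:R * (mu (etgt c) / mu (finish v es)))%:C%C *: pvec v es.
Proof.
rewrite /sharp_term /sharp_coef big_ord1 size_rcons subn1 [_.-1]/=.
rewrite /delta_edges -cats1 (take_size_cat _ erefl) onth_cat ltnn subnn !map_cat.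
rewrite last_cat [drop _ _]/= cats0 [last _ _]/=.
have -> : nth v (v :: map (@etgt R G) es ++ map (@etgt R G) [:: c]) (size es) =
          finish v es.
  by rewrite (last_nth v) size_map -cat_cons nth_cat /= size_map ltnSn.
by [].
Qed.

(** Reversal turns creation into the term of # without cancellation and annihilation into the term
    with one; the coefficients are real, so conjugation fixes them. *)
Lemma star_lmul_edge e x :
  star (lmul_edge e x) = sharp (star x) (pvec (etgt e) [:: erev e]).
Proof.
move: x; apply: pathspace_ind => [|a x y Px Py|v es wv].
- by rewrite star0 bilext0l (linear0 (lmul_edge e)) star0.
- have -> := lmul_edge_is_linear e a x y.
  have -> := starP a (lmul_edge e x) (lmul_edge e y).
  have -> := starP a x y.
  have -> := bilextPl (@sharp_path R G) a^* (star x) (star y) (pvec (etgt e) [:: erev e]).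
  exact: (f_equal2 (fun z z' : pathspace G => a^* *: z + z') Px Py).
have wr : walk (etgt e) [:: erev e] by rewrite /= esrc_erev eqxx.
rewrite (star_pvec wv).
have wrev := walk_rev wv; rewrite (sharp_pvec_minn wrev wr) (finish_rev wv).
have [ve|ve] := eqVneq v (etgt e); last by rewrite (lmul_edge_pvec_neq _ ve) star0.
move: wv wrev; rewrite {}ve => wv wrev.
have wev : walk (esrc e) (e :: es) by rewrite /= eqxx.
rewrite /lmul_edge creation_pvec starD (star_pvec wev) size_rev size_map.
case: es wv wrev wev => [|b es] wv wrev wev.
  rewrite annihilation_pvec0 star0 addr0 big_ord1 /sharp_term /sharp_coef big_ord0.
  by rewrite /= divff ?mul1r ?scale1r // lt0r_neq0 // mu_gt0.
have eb : esrc b = etgt e by case/andP: wv => /eqP.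
have wb : walk (etgt b) es by case/andP: wv.
have sz : size (rev (map (@erev R G) (b :: es))) = (size es).+1.
  by rewrite size_rev size_map.
have mn : minn (size (b :: es)) 1 = 1%N by rewrite /=; lia.
rewrite mn big_ord_recr big_ord1 /= annihilation_pvec starZ.
have er : rev (map (@erev R G) (b :: es)) = rcons (rev (map (@erev R G) es)) (erev b).
  by rewrite -rev_cons.
have -> : rev [seq erev i | i <- e :: b :: es] =
    rev [seq erev i | i <- b :: es] ++ [:: erev e].
  by rewrite cats1 -rev_cons.
rewrite er sharp_term0 sharp_term_rcons1 (finish_rev wb) erevK etgt_erev eb.
apply: (f_equal2 (fun z z' : pathspace G => z + z')) => [//|].
have -> : (erev b == e) = (e == erev b) by rewrite eq_sym.
have -> : (((e == erev b)%:R * (mu (etgt e) / mu (etgt b)))%:C%C)^* =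
    ((e == erev b)%:R * (mu (etgt e) / mu (etgt b)))%:C%C.
  exact: conjc_real.
have [ee|ne] := eqVneq e (erev b); last by rewrite mul0r [LHS]scale0r [RHS]scale0r.
by rewrite ee esrc_erev (star_pvec wb).
Qed.

Lemma phi_star x : phi (star x) = star (phi x).
Proof.
move: x; apply: pathspace_ind => [|a x y Px Py|v es].
- by rewrite star0 phi0 star0.
- have -> := starP a x y; have -> := phi_is_linear a^* (star x) (star y).
  have -> := phi_is_linear a x y; have -> := starP a (phi x) (phi y).
  exact: (f_equal2 (fun z z' : pathspace G => a^* *: z + z') Px Py).
elim: es v => [|e es IH] v /= wv.
  by rewrite phi_vertex star_pvec // phi_vertex.
have we : walk (etgt e) es by case/andP: wv.
have ev : esrc e = v by case/andP: wv => /eqP.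
have wev : walk (esrc e) (e :: es) by rewrite /= eqxx.
rewrite -ev (star_pvec wev) (phi_cons we) star_lmul_edge.
have H := IH _ we; rewrite -H (star_pvec we).
have wr : walk (etgt e) [:: erev e] by rewrite /= esrc_erev eqxx.
(* A path of length one is fixed by [phi], so the right factor is an image and [phiM] applies. *)
have <- : phi (pvec (etgt e) [:: erev e]) = pvec (etgt e) [:: erev e].
  rewrite -{1}[etgt e](esrc_erev (g := G)) (phi_cons (erefl : walk (etgt (erev e)) [::])).
  rewrite phi_vertex /lmul_edge annihilation_pvec0 addr0 creation_pvec.
  by rewrite esrc_erev.
rewrite -phiM (concat_pvec (walk_rev we) wr) (finish_rev we) eqxx.
have -> : rev [seq erev i | i <- e :: es] = rev [seq erev i | i <- es] ++ [:: erev e].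
  by rewrite cats1 -rev_cons.
exact: erefl.
Qed.

Local Notation psi := (@psi R G : pathspace G -> pathspace G).

Lemma psiM x y : psi (sharp x y) = concat (psi x) (psi y).
Proof.
have H : phi (concat (psi x) (psi y)) = sharp x y :=
  etrans (phiM (psi x) (psi y))
    (f_equal2 (bilext (@sharp_path R G)) (psiK x) (psiK y)).
exact: (etrans (f_equal psi (esym H)) (phiK (concat (psi x) (psi y)))).
Qed.

Lemma psi_star x : psi (star x) = star (psi x).
Proof.
have H : phi (star (psi x)) = star x :=
  etrans (phi_star (psi x)) (f_equal (@star R G) (psiK x)).
exact: (etrans (f_equal psi (esym H)) (phiK (star (psi x)))).
Qed.

End Products.

(** * Regions of a diagram and the Kreweras complement *)

Section Kreweras.
Variables (n : nat) (p : {ffun 'I_n -> 'I_n}).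
Hypothesis ncp : ncinv p.

Let pK : involutive p.
Proof. by case/ncinvP: ncp. Qed.

Let nc : forall i j : 'I_n, (i < j < p i)%N ->
  [&& p j != j, i < p j & p j < p i]%N.
Proof. by case/ncinvP: ncp. Qed.

(* The left ends of the caps under which the primed point [c'] lies. *)
Definition covering (c : 'I_n) : {set 'I_n} := [set a : 'I_n | (a <= c < p a)%N].

Definition regions : {set {set 'I_n}} := preim_partition covering [set: 'I_n].

Lemma regionsP B :
  reflect (exists x, B = [set y | covering x == covering y]) (B \in regions).
Proof.
apply: (iffP imsetP) => [[x _ ->]|[x ->]]; exists x => //.
  by apply/setP => y; rewrite !inE.
by apply/setP => y; rewrite !inE.
Qed.

Lemma regions_partition : partition regions [set: 'I_n].
Proof. exact: preim_partitionP. Qed.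

(** A cap over [a] and [c] also covers [b], and a cap over [b] and [d] also covers [c]. *)
Lemma covering_between (a b c d : 'I_n) : (a < b)%N -> (b < c)%N -> (c < d)%N ->
  covering a = covering c -> covering b = covering d -> covering a = covering b.
Proof.
move=> ab bc cd ac bd; rewrite ac; apply/setP => x; apply/idP/idP => xc.
  have : x \in covering a by rewrite ac.
  by move: xc; rewrite !inE; lia.
have : x \in covering d by rewrite -bd.
by move: xc; rewrite !inE; lia.
Qed.

Lemma regions_compatible : kreweras_compatible (caps (diagram_of p)) regions.
Proof.
rewrite /kreweras_compatible regions_partition /=.
have ncT : noncrossing (@nat_of_ord n) (caps (diagram_of p)).
  by case/andP: (diagram_of_epi ncp) => /and3P[].
apply/forall_inP => B BU; apply/forall_inP => C CU.
apply/forall_inP => a aB; apply/forall_inP => b bC.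
apply/forall_inP => c cB; apply/forall_inP => d dC.
apply/implyP => /and3P[ab bc cd].
move: BU CU aB bC cB dC ab bc cd; rewrite !in_setU.
(* Each of the two blocks is a cap or a region. In the mixed cases the cap covers exactly one of two
   points of a single region. *)
case/orP => /imsetP[B' BS ->]; case/orP => /imsetP[C' CS ->];
  case/imsetP=> a' aB ->; case/imsetP=> b' bC ->;
  case/imsetP=> c' cB ->; case/imsetP=> d' dC -> /=;
  rewrite ?ltnS ?ltn_double => ab bc cd.
- move/forall_inP/(_ _ BS)/forall_inP/(_ _ CS): ncT.
  move/forall_inP/(_ _ aB)/forall_inP/(_ _ bC).
  move/forall_inP/(_ _ cB)/forall_inP/(_ _ dC).
  by rewrite ab bc cd /= => /eqP ->.
- have ac : (a' < c')%N by lia.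
  have E := cap_lt ncp BS aB cB ac.
  case/regionsP: CS => x CE; move: bC dC; rewrite CE !inE => /eqP -> /eqP/setP/(_ a').
  by rewrite !inE -E; move: ab bc cd; lia.
- have bd : (b' < d')%N by lia.
  have E := cap_lt ncp CS bC dC bd.
  case/regionsP: BS => x BE; move: aB cB; rewrite BE !inE => /eqP -> /eqP/setP/(_ b').
  by rewrite !inE -E; move: ab bc cd; lia.
case/regionsP: BS => x BE; case/regionsP: CS => y CE.
move: aB bC cB dC; rewrite BE CE !inE => /eqP aB /eqP bC /eqP cB /eqP dC.
have -> : covering x = covering y; last exact: eqxx.
rewrite aB bC; apply: (@covering_between a' b' c' d').
- by move: ab bc cd; lia.
- by move: ab bc cd; lia.
- by move: ab bc cd; lia.
- by rewrite -aB -cB.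
- by rewrite -bC -dC.
Qed.

(** A cap covering [c] but not [d] would separate the two primed points and so cross their block. *)
Lemma compatible_covering K : kreweras_compatible (caps (diagram_of p)) K ->
  forall B c d, B \in K -> c \in B -> d \in B -> covering c \subset covering d.
Proof.
case/andP=> _ ncK B c d BK cB dB; apply/subsetP => x; rewrite !inE => xc.
have xp : p x != x by rewrite -val_eqE /=; move: xc; lia.
have TX : inl @: [set x; p x] \in interleaved_union (caps (diagram_of p)) K.
  by rewrite in_setU imset_f // caps_pair_partner // eqxx andbT.
have TB : inr @: B \in interleaved_union (caps (diagram_of p)) K.
  by rewrite in_setU imset_f ?orbT.
have neq : (inl @: [set x; p x] == inr @: B :> {set 'I_n + 'I_n}) = false.
  apply/eqP => /setP/(_ (inl x)); rewrite imset_f ?set21 // => /esym/imsetP[] //.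
have neq' : (inr @: B == inl @: [set x; p x] :> {set 'I_n + 'I_n}) = false.
  by rewrite eq_sym.
apply: contraT => xd; case: (ltnP d x) => dx.
  move/forall_inP/(_ _ TB)/forall_inP/(_ _ TX): ncK.
  move/forall_inP/(_ _ (imset_f inr dB))/forall_inP/(_ _ (imset_f inl (set21 _ _))).
  move/forall_inP/(_ _ (imset_f inr cB))/forall_inP/(_ _ (imset_f inl (set22 _ _))).
  by rewrite neq' implybF /=; move: xc xd dx; lia.
move/forall_inP/(_ _ TX)/forall_inP/(_ _ TB): ncK.
move/forall_inP/(_ _ (imset_f inl (set21 _ _)))/forall_inP/(_ _ (imset_f inr cB)).
move/forall_inP/(_ _ (imset_f inl (set22 _ _)))/forall_inP/(_ _ (imset_f inr dB)).
by rewrite neq implybF /=; move: xc xd dx; lia.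
Qed.

(** A block [B] lies in some [C], which lies in some [B']; disjointness gives [B = B'], hence
    [C = B]. *)
Lemma refines_partition_eq (X : finType) (P Q : {set {set X}}) D :
  partition P D -> partition Q D -> refines P Q -> refines Q P -> P \subset Q.
Proof.
move=> /and3P[_ /trivIsetP tP P0] _ /forall_inP PQ /forall_inP QP.
apply/subsetP => B BP; have /exists_inP[C CQ BC] := PQ _ BP.
have /exists_inP[B' BP' CB'] := QP _ CQ.
have BB' : B = B'.
  apply: contraTeq (BP) => /(tP _ _ BP BP').
  have BsB' := subset_trans BC CB'.
  rewrite -setI_eq0 (setIidPl BsB') => /eqP ->; exact: P0.
suff -> : B = C by [].
by apply/eqP; rewrite eqEsubset BC BB'.
Qed.

Lemma krewerasE : kreweras (caps (diagram_of p)) = regions.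
Proof.
have kr : is_kreweras (caps (diagram_of p)) regions.
  rewrite /is_kreweras regions_compatible /=; apply/forallP => K; apply/implyP => cK.
  apply/forall_inP => B BK; apply/exists_inP.
  have /and3P[_ _ K0] : partition K [set: 'I_n] by case/andP: cK.
  have [x xB] : exists x, x \in B by apply/set0Pn; apply: contraNneq K0 => <-.
  exists [set y | covering x == covering y]; first by apply/regionsP; exists x.
  apply/subsetP => y yB; rewrite inE eqEsubset.
  by rewrite !(compatible_covering cK BK).
(* The chosen partition and [regions] are both largest, so they refine each other. *)
rewrite /kreweras; case: pickP => [K kK /=|/(_ regions)]; last by rewrite kr.
have /andP[cK mK] := kK; have /andP[cr mr] := kr.
have /andP[pK' _] := cK; have /andP[pr _] := cr.
have rK := implyP (forallP mr K) cK; have Kr := implyP (forallP mK regions) cr.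
by apply/eqP; rewrite eqEsubset !(@refines_partition_eq _ _ _ [set: 'I_n]).
Qed.

Hypothesis p_neq : forall i, p i != i.

Lemma closerP (i : 'I_n) : ~~ (i < p i)%N -> (p i < i)%N.
Proof. by have := p_neq i; rewrite -val_eqE /=; lia. Qed.

(** A left end belongs to its own covering set, so [a <= c] and [c <= a]. *)
Lemma opener_covering (a c : 'I_n) : (a < p a)%N -> (c < p c)%N ->
  covering a = covering c -> a = c.
Proof.
move=> aa cc /setP E; have := E a; have := E c; rewrite !inE => h1 h2.
by apply/val_inj => /=; move: h1 h2; lia.
Qed.

(** The largest left end belongs to the innermost cap over [c], which bounds the region of [c]. *)
Lemma covering_opener c : covering c != set0 ->
  exists2 a : 'I_n, (a < p a)%N & covering a = covering c.
Proof.
case/set0Pn => a0 a0c; case: (@arg_maxnP _ a0 (mem (covering c)) (@nat_of_ord n) a0c).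
move=> a ac0 amax; have ac : a \in covering c := ac0.
move: (ac); rewrite inE => ac'; exists a; first by lia.
apply/setP => x; apply/idP/idP => xa; last first.
  by have := amax x xa; move: xa; rewrite !inE; lia.
move: xa; rewrite !inE => xa.
have [->|xna] := eqVneq x a; first by lia.
have := @nc x a; move: xna; rewrite -val_eqE /= => xna.
by move=> /(_ ltac:(lia)) /and3P[]; lia.
Qed.

(** The primed points just before and just after a cap lie in the same region, as no other cap
    separates them. *)
Lemma covering_closer (c c' : 'I_n) : (p c < c)%N -> c'.+1 = p c :> nat ->
  covering c = covering c'.
Proof.
move=> pc c'p; apply/setP => x; rewrite !inE.
have [->|xc] := eqVneq x c; first by lia.
have [->|xpc] := eqVneq x (p c); first by rewrite pK; lia.
have px : p x != p c by rewrite (ncinv_inj ncp).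
move: xc xpc px; rewrite -!val_eqE /= => xc xpc px.
have h1 := @nc (p c) x; have h2 := @nc x (p c); rewrite !pK in h1 h2.
case: (ltnP x (p c)) => [xl|xg].
  case: (ltnP (p c) (p x)) => [pl|pg]; last by lia.
  by have /and3P[] := h2 ltac:(lia); lia.
case: (ltnP x c) => xc'; last by lia.
by have /and3P[] := h1 ltac:(lia); lia.
Qed.

Lemma covering_closer0 (c : 'I_n) : (p c < c)%N -> p c = 0%N :> nat -> covering c = set0.
Proof.
move=> pc p0; apply/setP => x; rewrite !inE; apply/negP => h.
have xpc : x != p c by apply: contraTneq h => ->; rewrite pK; lia.
have xc : x != c by apply: contraTneq h => ->; lia.
move: xc xpc; rewrite -!val_eqE /= => xc xpc.
by have := @nc (p c) x; rewrite pK => /(_ ltac:(lia)) /and3P[]; lia.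
Qed.

(** Jumping over a cap returns to the vertex before it. Walking leftwards in this way leads to the
    left boundary of the region: the start of the path, or the left end of the enclosing cap. *)
Lemma region_vertex (X : Type) (V : nat -> X) :
  (forall c : 'I_n, (p c < c)%N -> V c.+1 = V (p c)) ->
  forall c : 'I_n, (covering c = set0 -> V c.+1 = V 0%N) /\
    (forall a : 'I_n, (a < p a)%N -> covering a = covering c -> V c.+1 = V a.+1).
Proof.
move=> hV c; have [m] := ubnP c; elim: m c => // m IH c cm.
case: (boolP (c < p c)%N) => [co|/closerP pc].
  split=> [E|a aa /(opener_covering aa co) -> //].
  by have : c \in covering c by [rewrite inE leqnn]; rewrite E inE.
rewrite hV //; case E: (nat_of_ord (p c)) => [|k].
  split=> // a aa; rewrite (covering_closer0 pc E) => /setP/(_ a).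
  by rewrite !inE leqnn aa.
have kn : (k < n)%N by have := ltn_ord (p c); rewrite E; exact: ltnW.
have Ek : (Ordinal kn).+1 = p c :> nat by rewrite E.
rewrite (covering_closer pc Ek); apply: (IH (Ordinal kn)) => /=.
by move: pc cm; rewrite E; lia.
Qed.

(** The square for a region is charged to its only left end, or to vertex 0 for the outer region,
    and the power [-#|C|] is spread over its points. A left end thus keeps [V], a right end
    [V^-1]. *)
Lemma prod_regions (F : fieldType) (V : nat -> F) (W : {set 'I_n} -> F) :
  (0 < n)%N -> (forall k, V k != 0) ->
  (forall c : 'I_n, (p c < c)%N -> V c.+1 = V (p c)) ->
  (forall C, C \in regions -> exists2 c : 'I_n, c \in C & W C = V c.+1) ->
  \prod_(C in regions) W C ^ (2 - #|C|%:Z) =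
  \prod_(i < n | (i < p i)%N) (V i.+1 / V (p i).+1) * V 0%N ^+ 2.
Proof.
move=> n0 V0 hV hW; pose C0 := [set y | covering y == set0].
pose f (c : 'I_n) := if (c < p c)%N then V c.+1 ^+ 2 else 1.
have C0r : C0 \in regions.
  (* The last primed point lies under no cap, so the outer region is nonempty. *)
  apply/regionsP; have lt : (n.-1 < n)%N by rewrite prednK.
  exists (Ordinal lt); apply/setP => y; rewrite !inE eq_sym; congr (_ == _).
  apply/esym/setP => x; rewrite !inE /=.
  by have := ltn_ord (p x); lia.
transitivity (\prod_(C in regions)
    ((if C == C0 then V 0%N ^+ 2 else 1) * \prod_(c in C) (f c * (V c.+1)^-1))).
  apply: eq_bigr => C CR; have [c cC ->] := hW _ CR.
  have [x CE] := regionsP _ CR.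
  have cx : covering x = covering c by move: cC; rewrite CE inE => /eqP.
  have inC y : (y \in C) = (covering y == covering c).
    by rewrite CE inE cx eq_sym.
  have VC y : y \in C -> V y.+1 = V c.+1.
    rewrite inC => /eqP yc; have [h0 ha] := region_vertex hV c.
    have [g0 ga] := region_vertex hV y.
    have [c0|/covering_opener [a aa ac]] := eqVneq (covering c) set0.
      by rewrite h0 // g0 // yc.
    by rewrite (ha a) // (ga a) // yc.
  rewrite big_split /= [X in _ * (_ * X)](_ : _ = (V c.+1)^-1 ^+ #|C|); last first.
    by rewrite -prodr_const; apply: eq_bigr => y /VC ->.
  rewrite expfzDr ?V0 // -exprnN -exprVn; rewrite mulrA; congr (_ * _).
  have -> : (C == C0) = (covering c == set0).
    apply/eqP/eqP => [E|E]; first by move: cC; rewrite E inE => /eqP.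
    by apply/setP => y; rewrite inC inE E.
  have [h0 ha] := region_vertex hV c.
  have [c0|/[dup] c0 /covering_opener [a aa ac]] := eqVneq (covering c) set0.
    rewrite big1 ?mulr1 ?h0 // => y; rewrite inC c0 => /eqP E.
    rewrite /f; case: ifP => // yy.
    by have : y \in covering y by [rewrite inE leqnn]; rewrite E inE.
  rewrite mul1r (bigD1 a) /=; last by rewrite inC ac.
  rewrite {1}/f aa (ha a) // big1 ?mulr1 // => y /andP[]; rewrite inC => /eqP yc ya.
  rewrite /f; case: ifP => // yy.
  by move: ya; rewrite (opener_covering yy aa) ?eqxx // yc.
rewrite big_split /= mulrC; congr (_ * _); last first.
  rewrite (bigD1 C0) //= eqxx big1 ?mulr1 // => C /andP[_].
  by move/negbTE ->.
have /and3P[/eqP cov triv _] := regions_partition.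
rewrite -(big_trivIset _ triv) /= cov.
rewrite [LHS](bigID (fun c : 'I_n => (c < p c)%N)) /=.
(* The right ends are indexed by their left ends, to pair the factors cap by cap. *)
have -> : \prod_(c in [set: 'I_n] | ~~ (c < p c)%N) (f c / V c.+1) =
          \prod_(c < n | (c < p c)%N) (V (p c).+1)^-1.
  rewrite (reindex_inj (can_inj pK)); apply: eq_big => [c|c /=].
    by rewrite inE /= pK; have := p_neq c; rewrite -val_eqE /=; lia.
  by rewrite /f => /andP[_ /negbTE ->]; rewrite mul1r.
have -> : \prod_(c in [set: 'I_n] | (c < p c)%N) (f c / V c.+1) =
          \prod_(c < n | (c < p c)%N) V c.+1.
  apply: eq_big => [c|c /andP[_ cc]]; first by rewrite inE.
  by rewrite /f cc expr2 mulfK.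
by rewrite -big_split.
Qed.

End Kreweras.

(** * The functionals *)

Section Functionals.
Variables (R : realType) (G : graph R).
Local Notation C := R[i]%C.

Lemma tau_TL_diagram (xi : gpath G) (p : {ffun 'I_(plen xi) -> 'I_(plen xi)}) :
  (0 < plen xi)%N -> ncinv p -> (forall i, p i != i) ->
  tau_TL (caps (diagram_of p)) = weight (edges xi) p * mu (psrc xi) ^+ 2.
Proof.
move=> n0 ncp pn; have pK : involutive p by case/ncinvP: ncp.
rewrite /tau_TL (prod_caps (fun i j : 'I_(plen xi) => edelta xi i xi j) ncp).
rewrite (krewerasE ncp) weight_edges big_split /= -mulrA.
set D := \prod_(i < _ | _) _; have [->|D0] := eqVneq D 0; first by rewrite !mul0r.
congr (_ * _).
(* A nonvanishing delta makes the edge at a right end the reverse of its partner, so it ends where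
   the partner starts. *)
have hV (c : 'I_(plen xi)) : (p c < c)%N -> mu (vtx xi c.+1) = mu (vtx xi (p c)).
  move=> pc; have : edelta xi (p c) xi c != 0.
    have /prodf_neq0 /(_ (p c)) := D0; rewrite pK; exact.
  have [b eb] := @onth_ord _ _ (edges xi) c.
  have [a ea] := @onth_ord _ _ (edges xi) (p c).
  rewrite (vtx_etgt eb) (vtx_esrc ea) /edelta ea eb /=.
  case: (eqVneq (Some a) (Some (erev b))) => [[->] _|_]; first by rewrite esrc_erev.
  by rewrite eqxx.
rewrite (prod_regions ncp pn (V := fun k => mu (vtx xi k)) n0) //.
  by move=> k; rewrite lt0r_neq0 // mu_gt0.
move=> C CR; rewrite /block_vertex; case: pickP => [c cC|C0]; first by exists c.
have [x CE] := regionsP p _ CR.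
by have := C0 x; rewrite CE inE eqxx.
Qed.

(** A Temperley-Lieb relation is a diagram without through-points, that is, an involution without
    fixed points. *)
Lemma sum_TL_rel n (F : {set {set 'I_n}} -> R) :
  \sum_(T | TL_rel T) F T =
  \sum_(p : {ffun 'I_n -> 'I_n} | ncinv p && [forall i, p i != i])
    F (caps (diagram_of p)).
Proof.
transitivity (\sum_(S | is_epi S && (through S == set0)) F (caps S)).
  rewrite [RHS](reindex_onto (fun T => (set0, T)) (@caps n)); last first.
    by move=> [T0 T] /= /andP[_ /eqP ->].
  apply: eq_bigl => T; rewrite /is_epi /= !eqxx !andbT setC0.
  rewrite -/(TL_rel T); case: (TL_rel T) => //=.
  apply/esym/forall_inP => B _; apply/forall_inP => a _; apply/forall_inP => b _.
  by apply/forall_inP => t; rewrite inE.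
rewrite sum_epi; apply: eq_bigl => p; congr (_ && _).
apply/eqP/forallP => [/setP E i|E]; first by have := E i; rewrite !inE => ->.
by apply/setP => i; rewrite !inE (negbTE (E i)).
Qed.

Lemma t_act v es (p : {ffun 'I_(size es) -> 'I_(size es)}) :
  fock_t (act v es p : Fock G) =
  (if [forall i, p i != i] then weight es p * mu v ^+ 2 else 0)%:C%C.
Proof.
rewrite /act /fock_t linextZ; case E: (fixed_points p) => [|k r].
  have -> : [forall i, p i != i].
    by apply/forallP => i; rewrite -mem_fixed_points E.
  have -> : through_edges es p = [::] by rewrite /through_edges E.
  rewrite (pvecE (isT : walk v [::])) linext_basis /t_path /=.
  by rewrite [RHS]rmorphM.
have -> : [forall i, p i != i] = false.
  by apply/negbTE/forallP => /(_ k); rewrite -mem_fixed_points E mem_head.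
have [b eb] := onth_ord k.
rewrite /through_edges E /= eb /=; set gs := _ :: _.
have [w|w] := boolP (walk v gs); last first.
  by rewrite (pvec_nwalk w) (linear0 (linext _)) scaler0.
by rewrite (pvecE w) linext_basis /t_path /= scaler0.
Qed.

Lemma fock_t_phi (x : Gr G) : fock_t (phi x) = tau x.
Proof.
move: x; apply: (@linear_eq _ _ (C^o)) => [a x y|a x y|v es w].
- by rewrite phi_is_linear /fock_t linext_is_linear.
- exact: linext_is_linear.
have -> : tau (pvec v es : Gr G) = tau_path (Sub (v, es) w : gpath G).
  by rewrite /tau (pvecE w) linext_basis.
set xi := Sub (v, es) w : gpath G.
(* Length zero is set apart: [tau_path] has its own clause there, and [tau_TL_diagram] assumes
   positive length. *)
have [es0|es0] := posnP (size es).
  have {es0}es0 : es = [::] by apply: size0nil.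
  move: w @xi; rewrite {}es0 => w /=.
  rewrite phi_vertex /fock_t (pvecE w) linext_basis.
  by rewrite /t_path /tau_path.
have n0 : (0 < plen xi)%N by [].
rewrite (phi_pvec w) /fock_t linext_sum /tau_path.
have -> : (plen xi == 0%N) = false by apply/negbTE; rewrite -lt0n.
rewrite sum_TL_rel rmorph_sum big_mkcond [RHS]big_mkcond /=.
apply: eq_bigr => p _; case: (boolP (ncinv p)) => //= ncp.
rewrite -/(fock_t (act v es p : Fock G)) t_act; case: ifP => // /forallP pn.
by rewrite (tau_TL_diagram n0 ncp pn).
Qed.

End Functionals.

Theorem proposition5 (R : realType) (G : graph R) :
  star_isomorphism (@phi R G) /\
  star_isomorphism (@psi R G) /\
  cancel (@phi R G) (@psi R G) /\
  cancel (@psi R G) (@phi R G) /\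
  (forall x : Gr G, fock_t (phi x) = tau x).
Proof.
split; [|split; [|split; [|split]]].
- split; [exact: phi_is_linear | exact: phiM | exact: phi_star |].
  by exists (@psi R G); [exact: phiK | exact: psiK].
- split; [exact: psi_is_linear | exact: psiM | exact: psi_star |].
  by exists (@phi R G); [exact: psiK | exact: phiK].
- exact: phiK.
- exact: psiK.
- exact: fock_t_phi.
Qed.
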